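(* Let $0<b_1<b_2<\infty$. Let $B$ be an optimal structure for a frequency $\alpha\in\mathbb{R}\setminus\{0\}$ and let $\kappa=\alpha+\mathrm{i}\,\mathcal{I}(\alpha)$ be the corresponding optimal quasi-eigenvalue. Then there exists $\omega\in[-\pi,\pi)$ such that, on the interval $(0,1)$, $B(x)$ changes its value from $b_1$ to $b_2$ exactly when $\varphi^2(x,\kappa;B)$ intersects the ray $e^{\mathrm{i}\omega}\mathbb{R}_+$, and $B$ changes its value from $b_2$ to $b_1$ exactly when $\varphi^2(x,\kappa;B)$ intersects the ray $e^{\mathrm{i}\omega}\mathbb{R}_-$. That is, for every $x\in(0,1)$: $B$ changes its value from $b_1$ to $b_2$ at $x$ if and only if $\varphi^2(x,\kappa;B)\in e^{\mathrm{i}\omega}\mathbb{R}_+$, and $B$ changes its value from $b_2$ to $b_1$ at $x$ if and only if $\varphi^2(x,\kappa;B)\in e^{\mathrm{i}\omega}\mathbb{R}_-$.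
   Context: $\mathbb{R}_\pm=\{x\in\mathbb{R}:\pm x>0\}$. $\mathrm{Ad}:=\{B\in L^\infty_{\mathbb{R}}(0,1): b_1\le B(x)\le b_2 \text{ for a.a. } x\in(0,1)\}$. For $B\in L^\infty(0,1)$, a number $\kappa\in\mathbb{C}$, $\kappa\ne0$, is called a quasi-eigenvalue of $B$ if there is a nonzero solution $y\in W^{2,\infty}_{\mathbb{C}}[0,1]$ of $y''(x)+\kappa^2B(x)y(x)=0$ for a.a. $x\in(0,1)$ with $y'(0)=0$ and $y(1)-\mathrm{i}\,y'(1)/\kappa=0$. $K(B)$ denotes the set of all quasi-eigenvalues of $B$, and $K(\mathrm{Ad}):=\bigcup_{B\in\mathrm{Ad}}K(B)$. By $\varphi(x)=\varphi(x,z;B)$ we denote the solution of $\varphi''=-z^2B\varphi$ on $(0,1)$ with $\varphi(0)=1$, $\varphi'(0)=0$. For $\alpha\in\mathbb{R}$ put $\mathcal{I}(\alpha):=+\infty$ if there is no $\kappa\in K(\mathrm{Ad})$ with $\operatorname{Re}\kappa=\alpha$; otherwise $\mathcal{I}(\alpha):=\min\{\operatorname{Im}\kappa:\operatorname{Re}\kappa=\alpha,\ \kappa\in K(\mathrm{Ad})\}$ (this minimum is attained and positive). A structure $B\in\mathrm{Ad}$ is called optimal for the frequency $\alpha$ if $\mathcal{I}(\alpha)<\infty$ and $\alpha+\mathrm{i}\,\mathcal{I}(\alpha)\in K(B)$. It is known that every optimal structure coincides a.e. with a piecewise constant function on $[0,1]$ (finitely many intervals of constancy) taking only the values $b_1$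 and $b_2$. ''$B$ changes its value from $b_i$ to $b_j$ at $x_0\in(0,1)$'' ($i\ne j$) means that for some $\epsilon>0$ one has $B=b_i$ a.e. on $(x_0-\epsilon,x_0)$ and $B=b_j$ a.e. on $(x_0,x_0+\epsilon)$. *)

(* Defs.v *)
From HB Require Import structures.
From mathcomp Require Import all_boot all_order all_algebra.
From mathcomp Require Import all_classical all_reals all_analysis.
From mathcomp Require Import complex.
Set Implicit Arguments.
Unset Strict Implicit.
Unset Printing Implicit Defensive.
Import Order.TTheory GRing.Theory Num.Theory.
Local Open Scope classical_set_scope.
Local Open Scope complex_scope.
Local Open Scope ring_scope.

(* Functions on (0,1) or [0,1] are represented by total functions on R whose
   values outside the interval are irrelevant. *)

Definition ae01 (R : realType) (P : R -> Prop) : Prop :=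
  {ae @lebesgue_measure R, forall x, x \in `]0, 1[ -> P x}.

Definition Linfty01 (R : realType) (f : R -> R) : Prop :=
  measurable_fun (`]0, 1[ : set R) f /\ exists M, ae01 (fun x => `|f x| <= M).

Definition cLinfty01 (R : realType) (f : R -> R[i]) : Prop :=
  Linfty01 (fun x => complex.Re (f x)) /\ Linfty01 (fun x => complex.Im (f x)).

Definition cintegral (R : realType) (D : set R) (f : R -> R[i]) : R[i] :=
  (\int[lebesgue_measure]_(t in D) complex.Re (f t)) +i*
  (\int[lebesgue_measure]_(t in D) complex.Im (f t)).

(* f is absolutely continuous on [0,1] with f' = g a.e. (for integrable g). *)
Definition primitive01 (R : realType) (f g : R -> R[i]) : Prop :=
  forall x, x \in `[0, 1] -> f x = f 0 + cintegral `[0, x] g.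

(* y is (the C^1 representative of) an element of the complex Sobolev space
   W^{2,oo}[0,1], with y' = y1 on [0,1] and y'' = y2 a.e.  As y2 is essentially
   bounded, y1 is Lipschitz, so both integrals are those of integrable
   functions. *)
Definition W2infty (R : realType) (y y1 y2 : R -> R[i]) : Prop :=
  [/\ cLinfty01 y2, primitive01 y1 y2 & primitive01 y y1].

(* y in W^{2,oo}[0,1] solves y'' + z^2 B y = 0 a.e. on (0,1), with y' = y1. *)
Definition solves (R : realType) (B : R -> R) (z : R[i]) (y y1 : R -> R[i])
    : Prop :=
  exists y2 : R -> R[i], W2infty y y1 y2 /\
    ae01 (fun x => y2 x + z ^+ 2 * (B x)%:C * y x = 0).

Definition is_phi (R : realType) (B : R -> R) (z : R[i]) (phi : R -> R[i])
    : Prop :=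
  exists phi1 : R -> R[i], [/\ solves B z phi phi1, phi 0 = 1 & phi1 0 = 0].

Definition Ad (R : realType) (b1 b2 : R) : set (R -> R) :=
  [set B | Linfty01 B /\ ae01 (fun x => b1 <= B x <= b2)].

(* K(B), the set of quasi-eigenvalues of B *)
Definition quasi_eigenvalues (R : realType) (B : R -> R) : set R[i] :=
  [set kappa | kappa != 0 /\ exists y y1 : R -> R[i],
    [/\ solves B kappa y y1,
        exists2 x, x \in `[0, 1] & y x != 0,
        y1 0 = 0
      & y 1 - 'i%C * y1 1 / kappa = 0]].

Definition quasi_eigenvalues_Ad (R : realType) (b1 b2 : R) : set R[i] :=
  \bigcup_(B in Ad b1 b2) quasi_eigenvalues B.

(* I(alpha), valued in the extended reals; the infimum of the empty set is +oo,
   and the infimum is a minimum whenever there is a structure optimal for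
   alpha (see optimal_min). *)
Definition Imin (R : realType) (b1 b2 alpha : R) : \bar R :=
  ereal_inf [set (complex.Im kappa)%:E | kappa in
    [set kappa | quasi_eigenvalues_Ad b1 b2 kappa /\ complex.Re kappa = alpha]].

(* alpha + i I(alpha), meaningful when I(alpha) is finite *)
Definition optimal_kappa (R : realType) (b1 b2 alpha : R) : R[i] :=
  alpha +i* fine (Imin b1 b2 alpha).

Definition optimal (R : realType) (b1 b2 alpha : R) (B : R -> R) : Prop :=
  [/\ Ad b1 b2 B, Imin b1 b2 alpha \is a fin_num
    & quasi_eigenvalues B (optimal_kappa b1 b2 alpha)].

Lemma optimal_min (R : realType) (b1 b2 alpha : R) (B : R -> R) :
  optimal b1 b2 alpha B ->
  quasi_eigenvalues_Ad b1 b2 (optimal_kappa b1 b2 alpha) /\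
  forall kappa, quasi_eigenvalues_Ad b1 b2 kappa -> complex.Re kappa = alpha ->
    complex.Im (optimal_kappa b1 b2 alpha) <= complex.Im kappa.
Proof.
move=> [AdB fI KB]; split; first by exists B.
move=> kappa Kk Rek; rewrite -lee_fin /= fineK //.
by apply: ereal_inf_lbound; exists kappa.
Qed.

(* B changes its value from c to d at x0; for x0 in (0,1) the intervals may be
   taken inside (0,1) by shrinking e. *)
Definition changes_value (R : realType) (B : R -> R) (c d x0 : R) : Prop :=
  exists2 e : R, 0 < e &
    {ae @lebesgue_measure R, forall x, x \in `]x0 - e, x0[ -> B x = c} /\
    {ae @lebesgue_measure R, forall x, x \in `]x0, x0 + e[ -> B x = d}.

(* the rays e^{i omega} R_+ and e^{i omega} R_- *)
Definition ray_pos (R : realType) (omega : R) : set R[i] :=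
  [set (cos omega +i* sin omega) * r%:C | r in [set r : R | 0 < r]].
Definition ray_neg (R : realType) (omega : R) : set R[i] :=
  [set (cos omega +i* sin omega) * r%:C | r in [set r : R | r < 0]].

(* Main.v *)
Require Import Defs.
From mathcomp Require Import all_boot all_order all_algebra.
From mathcomp Require Import all_classical all_reals all_analysis.
From mathcomp Require Import complex measurable_realfun.
From mathcomp Require Import ring lra.
Set Implicit Arguments.
Unset Strict Implicit.
Unset Printing Implicit Defensive.
Import Order.TTheory GRing.Theory Num.Theory.
Import numFieldNormedType.Exports.
Import Normc.
Local Open Scope classical_set_scope.
Local Open Scope complex_scope.
Local Open Scope ring_scope.

(** Write kappa = alpha + i I(alpha), let phi be the solution for B and kappa,
    and let g = Re (w phi^2) for a complex number w <> 0 to be found.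

    The first-order condition.  Replacing B by B + V changes the boundary
    function z |-> y'(1) + i z y(1) at z = kappa, to first order, by a multiple of
    the first variation \int phi^2 V.  Suppose that the variations in admissible
    directions V fill the complex plane.  Then, for every z near kappa, the
    equation for z to be a quasi-eigenvalue can be solved for the increment V, by
    Banach's theorem in a disc of first variations ([quasi_eigenvalue_moves]);
    kappa may be a multiple zero, because z is prescribed and V is the unknown.
    With z = kappa - i s^2 this contradicts the minimality of Im kappa.  So the
    convex cone of first variations is not the plane and lies in a half-plane
    ([separation]): for some w <> 0, Re (w \int phi^2 (C - B)) <= 0 for all
    admissible C ([variation_halfplane]).  As B maximizes a linear functional
    with density g, it equals b2 where g > 0 and b1 where g < 0 ([bang_bang]).

    The rotation.  We have (Im (conj phi phi'))' = - 2 alpha Im kappa B |phi|^2,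
    and Im kappa <> 0 by the boundary condition at 1 ([quasi_eigenvalue_nonreal]).
    Hence on (0, 1] phi does not vanish and turns about the origin strictly in one
    direction ([phi_rotates]).  The zeros of g are the points where phi^2 meets
    a certain line through 0; there g' is nonzero, and its sign depends only on
    the half of the line that is met ([weight_derivative]).  So B jumps from b1 to
    b2 when phi^2 meets one of the two rays, from b2 to b1 when it meets the
    other one, and it has no other points of change, since B is constant near
    a point where g <> 0.

    The equation y'' + q y = 0 with bounded measurable q is treated as a Volterra
    integral equation.  Its solutions come from Banach's theorem in an
    exponentially weighted norm ([weighted_contraction]).  Products of solutions
    are integrated by parts ([primitiveM]), which gives the Wronskian identities
    behind both parts of the argument ([ivp_wronskian]). *)

(** * The modulus of a complex number *)

Section modulus.
Context {R : realType}.
Implicit Types z w : R[i].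

Lemma normc_ge0 z : 0 <= normc z.
Proof. by case: z => a b; rewrite /= sqrtr_ge0. Qed.

Lemma normc_eq0 z : (normc z == 0) = (z == 0).
Proof. by apply/eqP/eqP => [/eq0_normc|->]; last exact: normc0. Qed.

Lemma normc_gt0 z : (0 < normc z) = (z != 0).
Proof. by rewrite lt_neqAle normc_ge0 andbT eq_sym normc_eq0. Qed.

Lemma normcB z w : normc (z - w) <= normc z + normc w.
Proof. by rewrite (le_trans (le_normcD _ _))// normcN. Qed.

Lemma distcC z w : normc (z - w) = normc (w - z).
Proof. by rewrite -normcN opprB. Qed.

Lemma normc_real (r : R) : normc r%:C = `|r|.
Proof. by rewrite /= expr0n /= addr0 sqrtr_sqr. Qed.

Lemma normc_i : normc ('i%C : R[i]) = 1.
Proof. by rewrite /= expr0n /= expr1n add0r sqrtr1. Qed.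

Lemma normr_Re z : `|complex.Re z| <= normc z.
Proof.
case: z => a b /=; rewrite -(sqrtr_sqr a) ler_sqrt ?lerDl ?sqr_ge0//.
by rewrite addr_ge0 ?sqr_ge0.
Qed.

Lemma normr_Im z : `|complex.Im z| <= normc z.
Proof.
case: z => a b /=; rewrite -(sqrtr_sqr b) ler_sqrt ?lerDr ?sqr_ge0//.
by rewrite addr_ge0 ?sqr_ge0.
Qed.

Lemma normc_le z : normc z <= `|complex.Re z| + `|complex.Im z|.
Proof.
case: z => a b /=; rewrite -(@ler_pXn2r _ 2)// ?nnegrE ?sqrtr_ge0 ?addr_ge0//.
rewrite sqr_sqrtr ?addr_ge0 ?sqr_ge0// sqrrD !real_normK ?num_real//.
by rewrite lerD2r lerDl mulrn_wge0 ?mulr_ge0.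
Qed.

Lemma cReB z w : complex.Re (z - w) = complex.Re z - complex.Re w.
Proof. by case: z w => [a b] [c d]. Qed.
Lemma cReD z w : complex.Re (z + w) = complex.Re z + complex.Re w.
Proof. by case: z w => [a b] [c d]. Qed.
Lemma cImB z w : complex.Im (z - w) = complex.Im z - complex.Im w.
Proof. by case: z w => [a b] [c d]. Qed.
Lemma cImD z w : complex.Im (z + w) = complex.Im z + complex.Im w.
Proof. by case: z w => [a b] [c d]. Qed.
Lemma cReM z w : complex.Re (z * w) =
  complex.Re z * complex.Re w - complex.Im z * complex.Im w.
Proof. by case: z w => [a b] [c d]. Qed.
Lemma cImM z w : complex.Im (z * w) =
  complex.Re z * complex.Im w + complex.Im z * complex.Re w.
Proof. by case: z w => [a b] [c d]. Qed.

End modulus.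

(** * Integrals of bounded measurable functions on [0, 1] *)

Section real_integral.
Context {R : realType}.
Implicit Types (f g : R -> R) (a b c x : R).
Notation mu := (@lebesgue_measure R).

Definition bmeas f := measurable_fun (`[0, 1] : set R) f /\
  exists M, forall x, 0 <= x <= 1 -> `|f x| <= M.

Lemma bmeas_cst c : bmeas (fun=> c).
Proof. by split => //; exists `|c|. Qed.

Lemma bmeasD f g : bmeas f -> bmeas g -> bmeas (fun x => f x + g x).
Proof.
move=> [mf [M fM]] [mg [N gN]]; split; first exact: measurable_funD.
by exists (M + N) => x x01; rewrite (le_trans (ler_normD _ _))// lerD ?fM ?gN.
Qed.

Lemma bmeasM f g : bmeas f -> bmeas g -> bmeas (fun x => f x * g x).
Proof.
move=> [mf [M fM]] [mg [N gN]]; split; first exact: measurable_funM.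
by exists (M * N) => x x01; rewrite normrM ler_pM ?fM ?gN.
Qed.

Lemma bmeasN f : bmeas f -> bmeas (fun x => - f x).
Proof.
move=> [mf [M fM]]; split; last by exists M => x; rewrite normrN; exact: fM.
exact: measurableT_comp.
Qed.

Lemma eq_bmeas f g : (forall x, 0 <= x <= 1 -> f x = g x) -> bmeas f -> bmeas g.
Proof.
move=> fg [mf [M fM]]; split; last by exists M => x x01; rewrite -fg ?fM.
apply: eq_measurable_fun mf => x; rewrite inE/= in_itv/=; exact: fg.
Qed.

Lemma bmeas_integrable f a b : bmeas f -> 0 <= a -> b <= 1 ->
  mu.-integrable `[a, b] (EFin \o f).
Proof.
move=> [mf [M fM]] a0 b1.
have sub : `[a, b] `<=` (`[0, 1] : set R).
  by apply: subset_itv; rewrite bnd_simp.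
apply: measurable_bounded_integrable => //.
- have : (mu `[a, b] < +oo)%E.
    by rewrite lebesgue_measure_itv; case: ifP => _; rewrite ?ltry// -EFinB ltry.
  by [].
- exact: measurable_funS mf.
- exists M; split; first exact: num_real.
  move=> N MN x /= xab; apply: le_trans (ltW MN); apply: fM.
  by have := sub _ xab; rewrite /= in_itv.
Qed.

Definition rint a b f := (\int[mu]_(t in `[a, b]) f t).

Lemma rintD a b f g : bmeas f -> bmeas g -> 0 <= a -> b <= 1 ->
  rint a b (fun x => f x + g x) = rint a b f + rint a b g.
Proof. by move=> bf bg a0 b1; rewrite /rint RintegralD//; exact: bmeas_integrable. Qed.

Lemma rintZ a b c f : bmeas f -> 0 <= a -> b <= 1 ->
  rint a b (fun x => c * f x) = c * rint a b f.
Proof. by move=> bf a0 b1; rewrite /rint RintegralZl//; exact: bmeas_integrable. Qed.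

Lemma eq_rint a b f g : 0 <= a -> b <= 1 ->
  (forall x, a <= x <= b -> f x = g x) -> rint a b f = rint a b g.
Proof.
by move=> a0 b1 fg; apply: eq_Rintegral => x; rewrite inE/= in_itv/=; exact: fg.
Qed.

Lemma rint_split a b c f : bmeas f -> 0 <= a -> a <= b -> b <= c -> c <= 1 ->
  rint a c f = rint a b f + rint b c f.
Proof.
move=> bf a0 ab bc c1.
have bfac := bmeas_integrable bf a0 c1.
have bf_oc : mu.-integrable `]b, c] (EFin \o f).
  by apply: integrableS bfac => //; apply: subset_itv; rewrite bnd_simp.
have := @Rintegral_itvB R f (BLeft a) (BRight c) b bfac.
rewrite !bnd_simp => /(_ ab bc) e; rewrite addrC; apply/eqP.
rewrite -subr_eq; apply/eqP; apply: etrans e _.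
exact: Rintegral_itv_obnd_cbnd.
Qed.

Lemma rint_cst a b c : a <= b -> rint a b (fun=> c) = c * (b - a).
Proof.
move=> ab; rewrite /rint Rintegral_cst//.
have muE : (mu `[a, b] = (b - a)%:E)%E.
  rewrite lebesgue_measure_itv/= lte_fin -EFinB.
  by case: ltgtP ab => // ->; rewrite subrr.
by rewrite [X in fine X]muE.
Qed.

Lemma ler_rint a b f g : bmeas f -> bmeas g -> 0 <= a -> b <= 1 ->
  (forall x, a <= x <= b -> f x <= g x) -> rint a b f <= rint a b g.
Proof.
by move=> bf bg a0 b1 fg; apply: le_Rintegral => //; exact: bmeas_integrable.
Qed.

Lemma rint_ge0 a b f : (forall x, a <= x <= b -> 0 <= f x) -> 0 <= rint a b f.
Proof.
by move=> f0; apply: Rintegral_ge0 => x; rewrite /= in_itv/=; exact: f0.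
Qed.

Lemma rint_point a f : rint a a f = 0.
Proof. by rewrite /rint set_itv1 Rintegral_set1. Qed.

Lemma ler_norm_rint a b f g : bmeas f -> bmeas g -> 0 <= a -> b <= 1 ->
  (forall x, a <= x <= b -> `|f x| <= g x) -> `|rint a b f| <= rint a b g.
Proof.
move=> bf bg a0 b1 fg.
rewrite (le_trans (le_normr_Rintegral _ (bmeas_integrable bf a0 b1)))//.
apply: ler_rint => //; have [mf [M fM]] := bf; split; last first.
  by exists M => x x01; rewrite normr_id fM.
exact: measurableT_comp.
Qed.

(** Lipschitz functions are continuous, hence measurable. *)
Lemma lipschitz_bmeas f K : (forall a b, 0 <= a -> a <= b -> b <= 1 ->
  `|f b - f a| <= K * (b - a)) -> bmeas f.
Proof.
move=> fK.
have K0 : 0 <= K.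
  by have := fK 0 1 (lexx _) ler01 (lexx _); rewrite subr0 mulr1; exact: le_trans.
split.
  apply: subspace_continuous_measurable_fun => //.
  apply/subspace_continuousP => x; rewrite /= in_itv/= => /andP[x0 x1].
  apply/cvgrPdist_lt => e e0; rewrite near_withinE; near=> t => /=.
  rewrite in_itv/= => /andP[t0 t1].
  apply: (@le_lt_trans _ _ (K * `|x - t|)).
    have [xt|tx] := leP x t.
      by rewrite distrC [in leRHS]distrC (ger0_norm (x := t - x)) ?subr_ge0// fK.
    by rewrite (ger0_norm (x := x - t)) ?subr_ge0 ?fK// ltW.
  apply: (@le_lt_trans _ _ ((K + 1) * `|x - t|)).
    by rewrite ler_wpM2r// lerDl.
  rewrite mulrC -ltr_pdivlMr ?ltr_wpDl//; near: t.
  by exists (e / (K + 1)) => //=; rewrite divr_gt0// ltr_wpDl.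
exists (`|f 0| + K) => x /andP[x0 x1].
rewrite -[f x](subrK (f 0)) addrC (le_trans (ler_normD _ _))// lerD2l.
by rewrite (le_trans (fK _ _ _ _ _))// subr0 ler_piMr.
Unshelve. all: by end_near. Qed.

(** Zero derivative in a quantitative form: cutting [0, x] into n equal parts
    bounds the increment by K x^2 / n. *)
Lemma quadratic_increments_cst f K : (forall a b, 0 <= a -> a <= b -> b <= 1 ->
  `|f b - f a| <= K * (b - a) ^+ 2) -> forall x, 0 <= x <= 1 -> f x = f 0.
Proof.
move=> fK x /andP[x0 x1].
have K0 : 0 <= K.
  have := fK 0 1 (lexx _) ler01 (lexx _); rewrite subr0 expr1n mulr1.
  exact: le_trans.
have bnd n : `|f x - f 0| <= K * (x ^+ 2 / n.+1%:R).
  pose p i := x * (i%:R / n.+1%:R).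
  have n0 : 0 < n.+1%:R :> R by [].
  have step i : (i <= n.+1)%N ->
      `|f (p i) - f 0| <= i%:R * (K * (x / n.+1%:R) ^+ 2).
    elim: i => [_|i IH lin]; first by rewrite /p mul0r mulr0 subrr normr0 mul0r.
    have -> : f (p i.+1) - f 0 = (f (p i) - f 0) + (f (p i.+1) - f (p i)).
      by ring.
    rewrite (le_trans (ler_normD _ _))// -natr1 mulrDl mul1r.
    rewrite lerD ?IH ?(ltnW lin)//.
    have -> : x / n.+1%:R = p i.+1 - p i.
      by rewrite /p -natr1; field.
    apply: fK; rewrite /p ?mulr_ge0 ?divr_ge0//.
      by rewrite ler_wpM2l// ler_pM2r ?invr_gt0// ler_nat.
    by rewrite mulr_ile1 ?divr_ge0// ler_pdivrMr// mul1r ler_nat.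
  have := step n.+1 (leqnn _); rewrite /p divff ?gt_eqF// mulr1 => /le_trans; apply.
  by rewrite le_eqVlt; apply/orP; left; apply/eqP; field.
apply/eqP; rewrite -subr_eq0 -normr_le0 leNgt; apply/negP => d0.
have [n] : exists n, K * x ^+ 2 / `|f x - f 0| < n%:R.
  exists (Num.bound (K * x ^+ 2 / `|f x - f 0|)); apply: archi_boundP.
  by rewrite divr_ge0// mulr_ge0// sqr_ge0.
rewrite ltr_pdivrMr// => Hn; have := bnd n.
rewrite mulrA ler_pdivlMr// => /le_lt_trans/(_ Hn).
by rewrite mulrC ltr_pM2r// ltr_nat ltnNge leqnSn.
Qed.

End real_integral.

Section complex_integral.
Context {R : realType}.
Implicit Types (f g : R -> R[i]) (a b x M : R) (c : R[i]).

Definition cbmeas f :=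
  bmeas (fun x => complex.Re (f x)) /\ bmeas (fun x => complex.Im (f x)).

Lemma cbmeas_cst c : cbmeas (fun=> c).
Proof. by split; exact: bmeas_cst. Qed.

Lemma cbmeasD f g : cbmeas f -> cbmeas g -> cbmeas (fun x => f x + g x).
Proof.
move=> [rf jf] [rg jg]; split.
  by apply: eq_bmeas (bmeasD rf rg) => x _; rewrite cReD.
by apply: eq_bmeas (bmeasD jf jg) => x _; rewrite cImD.
Qed.

Lemma cbmeasM f g : cbmeas f -> cbmeas g -> cbmeas (fun x => f x * g x).
Proof.
move=> [rf jf] [rg jg]; split.
  apply: eq_bmeas (bmeasD (bmeasM rf rg) (bmeasN (bmeasM jf jg))) => x _.
  by rewrite cReM.
by apply: eq_bmeas (bmeasD (bmeasM rf jg) (bmeasM jf rg)) => x _; rewrite cImM.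
Qed.

Lemma cbmeasZ c f : cbmeas f -> cbmeas (fun x => c * f x).
Proof. exact: (cbmeasM (cbmeas_cst c)). Qed.

Lemma cbmeasN f : cbmeas f -> cbmeas (fun x => - f x).
Proof.
move=> bf; have := cbmeasZ (-1) bf; congr cbmeas.
by apply/funext => x; rewrite mulN1r.
Qed.

Lemma cbmeasB f g : cbmeas f -> cbmeas g -> cbmeas (fun x => f x - g x).
Proof. by move=> bf bg; exact: cbmeasD bf (cbmeasN bg). Qed.

Lemma cbmeas_real (h : R -> R) : bmeas h -> cbmeas (fun x => (h x)%:C).
Proof. by move=> bh; split => //=; exact: bmeas_cst. Qed.

Lemma eq_cbmeas f g : (forall x, 0 <= x <= 1 -> f x = g x) ->
  cbmeas f -> cbmeas g.
Proof. by move=> fg [bf jf]; split; [move: bf|move: jf]; apply: eq_bmeas => x /fg ->. Qed.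

Lemma cbmeas_bounded f : cbmeas f ->
  exists2 M, 0 <= M & forall x, 0 <= x <= 1 -> normc (f x) <= M.
Proof.
move=> [[_ [M fM]] [_ [N fN]]]; exists (`|M| + `|N|); first by rewrite addr_ge0.
move=> x x01; rewrite (le_trans (normc_le _))// lerD//.
  by rewrite (le_trans (fM _ x01))// ler_norm.
by rewrite (le_trans (fN _ x01))// ler_norm.
Qed.

Definition cint a b f : R[i] := cintegral `[a, b] f.

Lemma Re_cint a b f : complex.Re (cint a b f) = rint a b (fun x => complex.Re (f x)).
Proof. by []. Qed.

Lemma Im_cint a b f : complex.Im (cint a b f) = rint a b (fun x => complex.Im (f x)).
Proof. by []. Qed.

Lemma eqc c c' : complex.Re c = complex.Re c' -> complex.Im c = complex.Im c' ->
  c = c'.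
Proof. by case: c c' => [a b] [a' b'] /= -> ->. Qed.

Lemma eq_cint a b f g : 0 <= a -> b <= 1 ->
  (forall x, a <= x <= b -> f x = g x) -> cint a b f = cint a b g.
Proof.
by move=> a0 b1 fg; apply: eqc; rewrite ?Re_cint ?Im_cint;
  apply: eq_rint => // x /fg ->.
Qed.

Lemma cintD a b f g : cbmeas f -> cbmeas g -> 0 <= a -> b <= 1 ->
  cint a b (fun x => f x + g x) = cint a b f + cint a b g.
Proof.
move=> [rf jf] [rg jg] a0 b1; apply: eqc.
  rewrite cReD !Re_cint -rintD//; apply: eq_rint => // x _; exact: cReD.
rewrite cImD !Im_cint -rintD//; apply: eq_rint => // x _; exact: cImD.
Qed.

Lemma cintZ a b c f : cbmeas f -> 0 <= a -> b <= 1 ->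
  cint a b (fun x => c * f x) = c * cint a b f.
Proof.
move=> [rf jf] a0 b1; apply: eqc.
  rewrite cReM !Re_cint Im_cint -!rintZ// -mulN1r -rintZ//; last first.
    exact: bmeasM (bmeas_cst _) _.
  rewrite -rintD//; last 2 first.
  - exact: bmeasM (bmeas_cst _) _.
  - exact: bmeasM (bmeas_cst _) (bmeasM (bmeas_cst _) _).
  by apply: eq_rint => // x _; rewrite cReM mulN1r.
rewrite cImM !Im_cint Re_cint -!rintZ// -rintD//; last 2 first.
- exact: bmeasM (bmeas_cst _) _.
- exact: bmeasM (bmeas_cst _) _.
by apply: eq_rint => // x _; rewrite cImM.
Qed.

Lemma cintN a b f : cbmeas f -> 0 <= a -> b <= 1 ->
  cint a b (fun x => - f x) = - cint a b f.
Proof.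
move=> bf a0 b1; rewrite -[RHS]mulN1r -cintZ//.
by apply: eq_cint => // x _; rewrite mulN1r.
Qed.

Lemma cintB a b f g : cbmeas f -> cbmeas g -> 0 <= a -> b <= 1 ->
  cint a b (fun x => f x - g x) = cint a b f - cint a b g.
Proof. by move=> bf bg a0 b1; rewrite cintD ?cintN//; exact: cbmeasN. Qed.

Lemma cint_split a b x f : cbmeas f -> 0 <= a -> a <= b -> b <= x -> x <= 1 ->
  cint a x f = cint a b f + cint b x f.
Proof.
move=> [rf jf] a0 ab bx x1; apply: eqc.
  by rewrite cReD !Re_cint; exact: rint_split.
by rewrite cImD !Im_cint; exact: rint_split.
Qed.

Lemma cint_cst a b c : a <= b -> cint a b (fun=> c) = c * (b - a)%:C.
Proof.
by move=> ab; apply: eqc; rewrite ?cReM ?cImM ?Re_cint ?Im_cint/= rint_cst//; ring.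
Qed.

Lemma cint_point a f : cint a a f = 0.
Proof. by apply: eqc; rewrite ?Re_cint ?Im_cint rint_point. Qed.

Lemma normc_cint a b f (h : R -> R) : cbmeas f -> bmeas h -> 0 <= a -> b <= 1 ->
  (forall x, a <= x <= b -> normc (f x) <= h x) ->
  normc (cint a b f) <= 2 * rint a b h.
Proof.
move=> [rf jf] bh a0 b1 fh; rewrite (le_trans (normc_le _))// mulr_natl mulr2n.
rewrite Re_cint Im_cint lerD//; apply: ler_norm_rint => // x /fh; apply: le_trans.
  exact: normr_Re.
exact: normr_Im.
Qed.

Lemma normc_cint_cst a b f M : cbmeas f -> 0 <= a -> a <= b -> b <= 1 ->
  (forall x, a <= x <= b -> normc (f x) <= M) ->
  normc (cint a b f) <= 2 * M * (b - a).
Proof.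
move=> bf a0 ab b1 fM.
by rewrite -mulrA -rint_cst// normc_cint//; exact: bmeas_cst.
Qed.

Lemma lipschitz_cbmeas f M : (forall a b, 0 <= a -> a <= b -> b <= 1 ->
  normc (f b - f a) <= M * (b - a)) -> cbmeas f.
Proof.
move=> fM; split; apply: (@lipschitz_bmeas _ _ M) => a b a0 ab b1.
  by rewrite -cReB (le_trans (normr_Re _))// fM.
by rewrite -cImB (le_trans (normr_Im _))// fM.
Qed.

End complex_integral.

(** * Indefinite integrals *)

Section primitives.
Context {R : realType}.
Implicit Types (f g : R -> R[i]) (a b x M : R).

(** Lipschitz functions on [0, 1], presented through their a.e. derivative. *)
Definition primitive f g :=
  cbmeas g /\ forall x, 0 <= x <= 1 -> f x = f 0 + cint 0 x g.

Lemma primitive_incr f g a b : primitive f g -> 0 <= a -> a <= b -> b <= 1 ->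
  f b - f a = cint a b g.
Proof.
move=> [bg fE] a0 ab b1; rewrite (fE b) ?(fE a) ?a0 ?b1 ?(le_trans a0 ab)//.
  by rewrite (cint_split bg _ a0 ab b1)//; ring.
by rewrite (le_trans ab b1).
Qed.

Lemma primitive_lipschitz f g : primitive f g ->
  exists2 M, 0 <= M & forall a b, 0 <= a -> a <= b -> b <= 1 ->
    normc (f b - f a) <= M * (b - a).
Proof.
move=> fg; have [bg _] := fg; have [M M0 gM] := cbmeas_bounded bg.
exists (2 * M); first exact: mulr_ge0.
move=> a b a0 ab b1; rewrite (primitive_incr fg)// normc_cint_cst// => x.
by move=> /andP[ax xb]; rewrite gM// (le_trans a0 ax) (le_trans xb b1).
Qed.

Lemma primitive_cbmeas f g : primitive f g -> cbmeas f.
Proof. by case/primitive_lipschitz => M _ /lipschitz_cbmeas. Qed.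

Lemma primitiveD (f1 g1 f2 g2 : R -> R[i]) : primitive f1 g1 -> primitive f2 g2 ->
  primitive (fun x => f1 x + f2 x) (fun x => g1 x + g2 x).
Proof.
move=> [b1 f1E] [b2 f2E]; split; first exact: cbmeasD.
by move=> x /andP[x0 x1]; rewrite cintD// f1E ?x0// f2E ?x0// addrACA.
Qed.

Lemma primitiveZ (k : R[i]) (f g : R -> R[i]) : primitive f g ->
  primitive (fun x => k * f x) (fun x => k * g x).
Proof.
move=> [bg fE]; split; first exact: cbmeasZ.
by move=> x /andP[x0 x1]; rewrite cintZ// -mulrDr -fE ?x0.
Qed.

(** The derivative varies by O(b - a) over [a, b], so freezing it at a point costs
    only O((b - a)^2). *)
Lemma primitive_taylor f g h : primitive f g -> primitive g h ->
  exists2 K, 0 <= K & forall x y, 0 <= x <= 1 -> 0 <= y <= 1 ->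
    normc (f y - f x - g x * (y - x)%:C) <= K * (y - x) ^+ 2.
Proof.
move=> fg gh; have [bg _] := fg.
have [M M0 gM] := primitive_lipschitz gh.
have dist a b : 0 <= a <= 1 -> 0 <= b <= 1 -> normc (g b - g a) <= M * `|b - a|.
  move=> /andP[a0 a1] /andP[b0 b1]; have [ab|ba] := leP a b.
    by rewrite ger0_norm ?subr_ge0// gM.
  by rewrite distcC distrC ger0_norm ?subr_ge0 ?gM// ltW.
have main a b c : 0 <= a -> a <= b -> b <= 1 -> a <= c <= b ->
    normc (f b - f a - g c * (b - a)%:C) <= 2 * M * (b - a) ^+ 2.
  move=> a0 ab b1 /andP[ac cb].
  rewrite (primitive_incr fg)// -cint_cst// -cintB//; last exact: cbmeas_cst.
  rewrite expr2 mulrA -[2 * M * (b - a)]mulrA.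
  rewrite normc_cint_cst//; first exact: cbmeasB bg (cbmeas_cst _).
  move=> x /andP[ax xb].
  rewrite (le_trans (dist _ _ _ _)) ?(le_trans a0) ?(le_trans _ b1)//=.
  by rewrite ler_wpM2l// ler_norml; apply/andP; split; lra.
exists (2 * M); first exact: mulr_ge0.
move=> x y /andP[x0 x1] /andP[y0 y1]; have [xy|yx] := leP x y.
  by apply: main; rewrite ?lexx.
have -> : f y - f x - g x * (y - x)%:C = - (f x - f y - g x * (x - y)%:C).
  by rewrite -[(y - x)]opprB rmorphN; ring.
rewrite normcN -sqrrN opprB; apply: main => //; first exact: ltW.
by rewrite lexx ltW.
Qed.

(** Integration by parts.  Over [a, b] the two sides differ by
    the integral of g1 (f2 b - f2) + (f1 a - f1) g2, which is quadratic
    in b - a, so that their difference is constant. *)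
Lemma primitiveM f1 g1 f2 g2 : primitive f1 g1 -> primitive f2 g2 ->
  primitive (fun x => f1 x * f2 x) (fun x => g1 x * f2 x + f1 x * g2 x).
Proof.
move=> p1 p2; have [b1 _] := p1; have [b2 _] := p2.
have bf1 := primitive_cbmeas p1; have bf2 := primitive_cbmeas p2.
have bG : cbmeas (fun x => g1 x * f2 x + f1 x * g2 x).
  by apply: cbmeasD; exact: cbmeasM.
split=> // x x01.
have [M1 M10 g1M] := cbmeas_bounded b1; have [M2 M20 g2M] := cbmeas_bounded b2.
have [L1 L10 f1L] := primitive_lipschitz p1.
have [L2 L20 f2L] := primitive_lipschitz p2.
pose h x := f1 x * f2 x - cint 0 x (fun x => g1 x * f2 x + f1 x * g2 x).
pose K := 2 * (M1 * L2 + L1 * M2).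
have hK a b : 0 <= a -> a <= b -> b <= 1 -> normc (h b - h a) <= K * (b - a) ^+ 2.
  move=> a0 ab le_b1.
  have -> : h b - h a = cint a b (fun t => g1 t * (f2 b - f2 t) +
                                           (f1 a - f1 t) * g2 t).
    rewrite /h (cint_split bG _ a0 ab)//.
    rewrite -[X in X - _ - _](subrK (f1 a * f2 a)).
    have -> : f1 b * f2 b - f1 a * f2 a =
              (f1 b - f1 a) * f2 b + f1 a * (f2 b - f2 a) by ring.
    rewrite !(primitive_incr p1, primitive_incr p2)//.
    rewrite [_ * f2 b]mulrC -!cintZ// -cintD//; [|exact: cbmeasZ|exact: cbmeasZ].
    set A := cint a b _; set C := cint a b _.
    rewrite [RHS](_ : _ = A - C); first by ring.
    rewrite /A /C -cintB//; last by apply: cbmeasD; exact: cbmeasZ.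
    by apply: eq_cint => // t _; ring.
  apply: (@le_trans _ _ (2 * ((M1 * L2 + L1 * M2) * (b - a)) * (b - a))).
    2: by rewrite /K expr2 !mulrA.
  apply: normc_cint_cst => //.
    by apply: cbmeasD; apply: cbmeasM => //; apply: cbmeasB => //;
      exact: cbmeas_cst.
  move=> t /andP[at_ tb]; rewrite (le_trans (le_normcD _ _))// [leRHS]mulrDl.
  have t01 : 0 <= t <= 1 by rewrite (le_trans a0 at_) (le_trans tb le_b1).
  have /andP[t0 t1] := t01.
  rewrite !normcM lerD//.
    rewrite -mulrA ler_pM ?normc_ge0 ?g1M//.
    by rewrite (le_trans (f2L _ _ _ _ _))// ler_wpM2l// lerD2l lerN2.
  rewrite mulrAC ler_pM ?normc_ge0 ?g2M// distcC.
  by rewrite (le_trans (f1L _ _ _ _ _))// ler_wpM2l// lerD2r.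
have hx : h x = h 0.
  apply: eqc.
    apply: (@quadratic_increments_cst _ (fun x => complex.Re (h x)) K) => // a b.
    by move=> *; rewrite -cReB (le_trans (normr_Re _))// hK.
  apply: (@quadratic_increments_cst _ (fun x => complex.Im (h x)) K) => // a b.
  by move=> *; rewrite -cImB (le_trans (normr_Im _))// hK.
by move: hx; rewrite /h cint_point subr0 => /eqP; rewrite subr_eq => /eqP.
Qed.

End primitives.

(** * Fixed points of contractions *)

Section contraction.
Context {R : realType}.

Lemma geometric_squeeze (x c : R) : (forall n, x <= c / 2 ^+ n) -> x <= 0.
Proof.
move=> xc; rewrite leNgt; apply/negP => x0.
have c0 : 0 < c by have := xc 0%N; rewrite expr0 divr1; exact: lt_le_trans.
have cx : c / x < (Num.bound (c / x))%:R.
  by apply: archi_boundP; rewrite divr_ge0 ?ltW.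
have := xc (Num.bound (c / x)); apply/negP; rewrite -ltNge.
rewrite ltr_pdivrMr ?exprn_gt0// mulrC -ltr_pdivrMr//.
rewrite (lt_trans cx)// -natrX ltr_nat; exact: ltn_expl.
Qed.

(** The limit is the supremum of the lower ends of the nested intervals of
    radius 2 c / 2^n around the terms. *)
Lemma geometric_limit (x : nat -> R) (c : R) :
  (forall n, `|x n.+1 - x n| <= c / 2 ^+ n) ->
  exists l, forall n, `|x n - l| <= 2 * c / 2 ^+ n.
Proof.
move=> xc; pose r n : R := 2 * c / 2 ^+ n.
have rS n : r n = r n.+1 + c / 2 ^+ n.
  by rewrite /r exprS invfM; field; rewrite expf_neq0.
have c0 : 0 <= c by have := xc 0%N; rewrite expr0 divr1; exact: le_trans.
have r0 n : 0 <= r n by rewrite divr_ge0 ?mulr_ge0 ?exprn_ge0.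
pose a n := x n - r n; pose b n := x n + r n.
have aS n : a n <= a n.+1.
  by have := xc n; rewrite ler_norml /a rS => /andP[]; lra.
have bS n : b n.+1 <= b n.
  by have := xc n; rewrite ler_norml /b [r n]rS => /andP[]; lra.
have ahomo m n : (m <= n)%N -> a m <= a n.
  by move=> /subnK <-; elim: (n - m)%N => // k IH; rewrite addSn (le_trans IH).
have bhomo m n : (m <= n)%N -> b n <= b m.
  by move=> /subnK <-; elim: (n - m)%N => // k IH; rewrite addSn (le_trans _ IH).
have ab m n : a m <= b n.
  have abk k : a k <= b k by rewrite /a /b; have := r0 k; lra.
  rewrite (le_trans (ahomo _ _ (leq_maxl m n)))// (le_trans (abk _))//.
  exact: bhomo (leq_maxr _ _).
have hs : has_sup (range a).
  by split; [exists (a 0%N), 0%N | exists (b 0%N) => _ [n _ <-]].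
exists (sup (range a)) => n; rewrite ler_norml; apply/andP; split.
  have : sup (range a) <= b n by apply: ge_sup => [|_ [m _ <-]//]; case: hs.
  by rewrite /b -/(r n); lra.
have : a n <= sup (range a) by apply: ub_le_sup; [case: hs|exists n].
by rewrite /a -/(r n); lra.
Qed.

(** Banach's fixed-point theorem for complex functions measured by a weighted
    supremum norm on D; closedness of the domain P is only asked along
    geometrically convergent sequences. *)
Lemma weighted_contraction (I : Type) (D : set I) (g : I -> R)
    (P : set (I -> R[i])) (T : (I -> R[i]) -> I -> R[i]) (f0 : I -> R[i]) :
  (forall h f M, (forall n : nat, P (h n)) ->
    (forall n i, D i -> normc (h n i - f i) <= M / 2 ^+ n * g i) -> P f) ->
  (forall f, P f -> P (T f)) ->
  (forall f f' e, P f -> P f' ->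
    (forall i, D i -> normc (f i - f' i) <= e * g i) ->
    forall i, D i -> normc (T f i - T f' i) <= e / 2 * g i) ->
  P f0 -> (exists M, forall i, D i -> normc (T f0 i - f0 i) <= M * g i) ->
  exists2 f, P f & forall i, D i -> T f i = f i.
Proof.
move=> Pcl PT contr P0 [M Tf0]; pose u n := iter n T f0.
have Pu n : P (u n) by elim: n => //= n; exact: PT.
have uS n i : D i -> normc (u n.+1 i - u n i) <= M / 2 ^+ n * g i.
  move=> Di; elim: n i Di => [i Di|n IH i Di]; first by rewrite expr0 divr1 Tf0.
  have -> : M / 2 ^+ n.+1 = M / 2 ^+ n / 2.
    by rewrite exprS; field; rewrite expf_neq0.
  exact: (contr _ _ _ (Pu n.+1) (Pu n)).
have lim i : exists l, D i -> forall n, normc (u n i - l) <= 4 * M / 2 ^+ n * g i.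
  have [Di|nDi] := pselect (D i); last by exists 0 => /nDi.
  have [|lr lrP] := @geometric_limit (fun n => complex.Re (u n i)) (M * g i).
    by move=> n; rewrite -cReB (le_trans (normr_Re _))// mulrAC uS.
  have [|li liP] := @geometric_limit (fun n => complex.Im (u n i)) (M * g i).
    by move=> n; rewrite -cImB (le_trans (normr_Im _))// mulrAC uS.
  exists (lr +i* li) => _ n; rewrite (le_trans (normc_le _))// cReB cImB/=.
  rewrite (le_trans (lerD (lrP n) (liP n)))// le_eqVlt; apply/orP; left.
  by apply/eqP; field; rewrite expf_neq0.
have [f fP] := choice lim; have Pf : P f.
  by apply: (Pcl u f (4 * M)) => // n i Di; exact: fP.
exists f => // i Di; apply/eqP; rewrite -subr_eq0 -normc_eq0 eq_le normc_ge0 andbT.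
apply: (@geometric_squeeze _ (4 * M * g i)) => n.
have -> : T f i - f i = - (T (u n) i - T f i) + (u n.+1 i - f i) by rewrite /=; ring.
rewrite (le_trans (le_normcD _ _))// normcN.
have := contr _ _ _ (Pu n) Pf (fun i Di => fP i Di n) i Di.
have := fP i Di n.+1; rewrite exprS => h1 h2.
rewrite (le_trans (lerD h2 h1))// le_eqVlt; apply/orP; left.
by apply/eqP; field; rewrite expf_neq0.
Qed.

End contraction.

(** * Linear Volterra equations *)

Section volterra.
Context {R : realType}.
Implicit Types (q r y f g : R -> R[i]) (a b c x e L M : R).
Notation mu := (@lebesgue_measure R).

Lemma continuous_expRM L : continuous (fun x : R => expR (L * x)).
Proof.
by move=> x; apply: continuous_comp; [exact: mulrl_continuous|exact: continuous_expR].
Qed.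

Lemma bmeas_expRM L : bmeas (fun x : R => expR (L * x)).
Proof.
split.
  by apply: measurable_funTS; apply: continuous_measurable_fun;
    exact: continuous_expRM.
exists (expR `|L|) => x /andP[x0 x1]; rewrite ger0_norm ?expR_ge0// ler_expR.
by rewrite (le_trans (ler_norm _))// normrM (ger0_norm x0) ler_piMr.
Qed.

Lemma rint_expRM_le L x : 0 < L -> 0 <= x ->
  rint 0 x (fun t => expR (L * t)) <= expR (L * x) / L.
Proof.
move=> L0; rewrite le_eqVlt => /predU1P[<-|x0].
  by rewrite rint_point divr_ge0 ?expR_ge0 ?ltW.
have cF : continuous (fun x : R => expR (L * x) / L).
  by move=> t; apply: cvgM; [exact: continuous_expRM|exact: cvg_cst].
have FE : (\int[mu]_(t in `[0%R, x]) (expR (L * t))%:E =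
    (expR (L * x) / L)%:E - (expR (L * 0) / L)%:E)%E.
  apply: (@continuous_FTC2 _ _ (fun x => expR (L * x) / L)) => //.
  - by apply: continuous_subspaceT; exact: continuous_expRM.
  - split.
    + by move=> z _; exact: ex_derive.
    + by apply: cvg_at_right_filter; exact: cF.
    + by apply: cvg_at_left_filter; exact: cF.
  - move=> z _; rewrite derive1E derive_val /GRing.scale/=.
    by field; rewrite gt_eqF.
rewrite /rint /Rintegral [X in fine X]FE/= gerBl.
by rewrite divr_ge0 ?expR_ge0 ?ltW.
Qed.

Lemma primitive_cint f : cbmeas f -> primitive (fun x => cint 0 x f) f.
Proof. by move=> bf; split=> // x _; rewrite cint_point add0r. Qed.

Lemma cbmeas_cint f : cbmeas f -> cbmeas (fun x => cint 0 x f).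
Proof. by move=> /primitive_cint/primitive_cbmeas. Qed.

Lemma bmeas_limit (h : nat -> R -> R) (f : R -> R) c : (forall n, bmeas (h n)) ->
  (forall n x, 0 <= x <= 1 -> `|h n x - f x| <= c / 2 ^+ n) -> bmeas f.
Proof.
move=> bh hf; split; last first.
  have [_ [M hM]] := bh 0%N; exists (c + M) => x x01.
  have := hf 0%N x x01; rewrite expr0 divr1 distrC => fx.
  by rewrite -(subrK (h 0%N x) (f x)) (le_trans (ler_normD _ _))// lerD ?hM.
apply: (@measurable_fun_cvg _ _ _ _ h) => [n|x]; first by case: (bh n).
rewrite /= in_itv/= => x01; apply/cvgrPdist_lt => e e0.
have c0 : 0 <= c by have := hf 0%N x x01; rewrite expr0 divr1; exact: le_trans.
exists (Num.bound (c / e)) => // n /= Nn.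
rewrite distrC (le_lt_trans (hf n x x01))// ltr_pdivrMr ?exprn_gt0//.
have ce0 : 0 <= c / e by rewrite divr_ge0// ltW.
rewrite mulrC -ltr_pdivrMr// (lt_le_trans (archi_boundP ce0))//.
by rewrite -natrX ler_nat (leq_trans Nn)// ltnW// ltn_expl.
Qed.

Lemma cbmeas_limit (h : nat -> R -> R[i]) f c : (forall n, cbmeas (h n)) ->
  (forall n x, 0 <= x <= 1 -> normc (h n x - f x) <= c / 2 ^+ n) -> cbmeas f.
Proof.
move=> bh hf; split.
  apply: (@bmeas_limit (fun n x => complex.Re (h n x)) _ c) => [n|n x x01].
    by case: (bh n).
  by rewrite -cReB (le_trans (normr_Re _))// hf.
apply: (@bmeas_limit (fun n x => complex.Im (h n x)) _ c) => [n|n x x01].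
  by case: (bh n).
by rewrite -cImB (le_trans (normr_Im _))// hf.
Qed.

Definition dint q y x := cint 0 x (fun s => cint 0 s (fun t => q t * y t)).

Lemma cbmeas_dint q y : cbmeas q -> cbmeas y -> cbmeas (dint q y).
Proof. by move=> bq by_; do 2 apply: cbmeas_cint; exact: cbmeasM. Qed.

Lemma dint_le q y x (A : R) : cbmeas q -> cbmeas y -> 0 <= x <= 1 -> 0 <= A ->
  (forall t, 0 <= t <= 1 -> normc (q t) * normc (y t) <= A) ->
  normc (dint q y x) <= 4 * A.
Proof.
move=> bq by_ /andP[x0 x1] A0 qy; have bqy := cbmeasM bq by_.
have inner s : 0 <= s <= x -> normc (cint 0 s (fun t => q t * y t)) <= 2 * A.
  move=> /andP[s0 sx]; have s1 := le_trans sx x1.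
  rewrite (le_trans (normc_cint_cst (M := A) _ _ _ _ _))//.
    by move=> t /andP[t0 ts]; rewrite normcM qy// t0 (le_trans ts).
  by rewrite subr0 ler_piMr ?mulr_ge0.
rewrite (le_trans (normc_cint_cst _ _ _ _ inner))//; first exact: cbmeas_cint.
by rewrite subr0 mulrA -natrM ler_piMr ?mulr_ge0.
Qed.

(** The weight expR (L x) turns the double integral into a contraction: each
    integration gains a factor 1 / L. *)
Lemma dint_contraction q y M e x : cbmeas q -> cbmeas y -> 0 <= x <= 1 ->
  (forall t, 0 <= t <= 1 -> normc (q t) <= M) ->
  let L := 8 * M + 1 in
  (forall t, 0 <= t <= 1 -> normc (y t) <= e * expR (L * t)) ->
  normc (dint q y x) <= e / 2 * expR (L * x).
Proof.
move=> bq by_ /andP[x0 x1] qM L yM; have bqy := cbmeasM bq by_.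
have M0 : 0 <= M by rewrite (le_trans _ (qM 0 _)) ?normc_ge0 ?lexx ?ler01.
have L0 : 0 < L by rewrite /L ltr_wpDl// mulr_ge0.
have e0 : 0 <= e.
  have := yM 0; rewrite lexx ler01 mulr0 expR0 mulr1 => /(_ isT); apply: le_trans.
  exact: normc_ge0.
have inner s : 0 <= s <= x ->
    normc (cint 0 s (fun t => q t * y t)) <= 2 * (M * e) / L * expR (L * s).
  move=> /andP[s0 sx]; have s1 := le_trans sx x1.
  rewrite (le_trans (normc_cint (h := fun t => M * e * expR (L * t)) _ _ _ _ _))//.
  - exact: bmeasM (bmeas_cst _) (bmeas_expRM _).
  - move=> t /andP[t0 ts]; have t1 := le_trans ts s1.
    by rewrite normcM -mulrA ler_pM ?normc_ge0 ?qM ?yM ?t0.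
  rewrite rintZ//; last exact: bmeas_expRM.
  have := rint_expRM_le L0 s0; set I := rint _ _ _ => Ile.
  have -> : 2 * (M * e) / L * expR (L * s) = 2 * (M * e * (expR (L * s) / L)).
    by ring.
  by rewrite ler_wpM2l// ler_wpM2l// mulr_ge0.
rewrite (le_trans (normc_cint _ _ _ _ inner))//.
- exact: cbmeas_cint.
- exact: bmeasM (bmeas_cst _) (bmeas_expRM _).
rewrite rintZ//; last exact: bmeas_expRM.
have := rint_expRM_le L0 x0; set I := rint _ _ _ => Ile.
apply: (@le_trans _ _ (2 * (2 * (M * e) / L * (expR (L * x) / L)))).
  rewrite ler_wpM2l// ler_wpM2l// divr_ge0//; last exact: ltW.
  by rewrite !mulr_ge0.
have -> : 2 * (2 * (M * e) / L * (expR (L * x) / L)) =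
    e * expR (L * x) * (4 * M / L ^+ 2) by field; rewrite gt_eqF.
(* Here L^2 >= 8 M, where 4 M comes from the two integrations of moduli. *)
rewrite [leRHS]mulrAC; apply: ler_wpM2l; first by rewrite mulr_ge0 ?expR_ge0.
rewrite ler_pdivrMr ?exprn_gt0// /L; nra.
Qed.

Lemma dintBr q y y' x : cbmeas q -> cbmeas y -> cbmeas y' -> 0 <= x <= 1 ->
  dint q (fun t => y t - y' t) x = dint q y x - dint q y' x.
Proof.
move=> bq by_ by' /andP[x0 x1]; have b1 := cbmeasM bq by_; have b2 := cbmeasM bq by'.
rewrite /dint -cintB//; try exact: cbmeas_cint.
apply: eq_cint => // s /andP[s0 sx]; have s1 := le_trans sx x1.
by rewrite -cintB//; apply: eq_cint => // t _; ring.
Qed.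

Lemma dintBl q q' y x : cbmeas q -> cbmeas q' -> cbmeas y -> 0 <= x <= 1 ->
  dint (fun t => q t - q' t) y x = dint q y x - dint q' y x.
Proof.
move=> bq bq' by_ /andP[x0 x1]; have b1 := cbmeasM bq by_; have b2 := cbmeasM bq' by_.
rewrite /dint -cintB//; try exact: cbmeas_cint.
apply: eq_cint => // s /andP[s0 sx]; have s1 := le_trans sx x1.
by rewrite -cintB//; apply: eq_cint => // t _; ring.
Qed.

Definition volterra q r y :=
  cbmeas y /\ forall x, 0 <= x <= 1 -> y x = r x - dint q y x.

Lemma volterra_exists q r : cbmeas q -> cbmeas r -> exists y, volterra q r y.
Proof.
move=> bq br; have [M M0 qM] := cbmeas_bounded bq.
pose L := 8 * M + 1; pose T y x := r x - dint q y x.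
have bT y : cbmeas y -> cbmeas (T y).
  by move=> by_; apply: cbmeasB => //; exact: cbmeas_dint.
have LE1 x : 0 <= x -> 1 <= expR (L * x).
  by move=> x0; rewrite -expR0 ler_expR mulr_ge0// addr_ge0// mulr_ge0.
have [|||y by_ yE] := @weighted_contraction R R [set x | 0 <= x <= 1]
    (fun x => expR (L * x)) cbmeas T (fun=> 0) _ bT _ (cbmeas_cst 0).
- move=> h f C bh hf.
  have hflim x : 0 <= x <= 1 -> forall n, normc (h n x - f x) <= C * expR L / 2 ^+ n.
    move=> x01 n; rewrite (le_trans (hf n x x01))// mulrAC ler_wpM2r//.
    have C0 : 0 <= C.
      have := hf 0%N 0; rewrite /= lexx ler01 mulr0 expR0 expr0 divr1 mulr1.
      by move=> /(_ isT); apply: le_trans; exact: normc_ge0.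
    case/andP: x01 => x0 x1; rewrite ler_wpM2l// ler_expR ler_piMr//.
    by rewrite addr_ge0// mulr_ge0.
  by apply: (@cbmeas_limit h f (C * expR L)) => // n x x01; exact: hflim.
- move=> f f' e bf bf' fe x x01.
  have -> : T f x - T f' x = - (dint q (fun t => f t - f' t) x).
    by rewrite dintBr// /T; ring.
  by rewrite normcN dint_contraction//; exact: cbmeasB.
- have [N N0 TN] := cbmeas_bounded (bT _ (cbmeas_cst 0)).
  exists N => x x01; rewrite subr0 (le_trans (TN x x01))// ler_peMr//.
  by apply: LE1; case/andP: x01.
by exists y; split => // x x01; rewrite -[LHS]yE.
Qed.

(** Gronwall's inequality, by iterating the contraction. *)
Lemma volterra_bound M : 0 <= M -> exists2 K, 0 <= K & forall q r y e,
  cbmeas q -> (forall x, 0 <= x <= 1 -> normc (q x) <= M) ->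
  volterra q r y -> (forall x, 0 <= x <= 1 -> normc (r x) <= e) ->
  forall x, 0 <= x <= 1 -> normc (y x) <= K * e.
Proof.
move=> M0; pose L := 8 * M + 1.
have L0 : 0 <= L by rewrite addr_ge0 ?mulr_ge0.
exists (2 * expR L); first by rewrite mulr_ge0 ?expR_ge0.
move=> q r y e bq qM [by_ yE] re x x01.
have [N N0 yN] := cbmeas_bounded by_.
have LE1 t : 0 <= t -> 1 <= expR (L * t).
  by move=> t0; rewrite -expR0 ler_expR mulr_ge0.
have e0 : 0 <= e by rewrite (le_trans _ (re _ x01))// normc_ge0.
have iter_le n t : 0 <= t <= 1 ->
    normc (y t) <= (2 * e + N / 2 ^+ n) * expR (L * t).
  elim: n t => [t t01|n IH t t01].
    rewrite expr0 divr1 (le_trans (yN _ t01))//.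
    rewrite (le_trans (ler_peMr N0 (LE1 t _)))//; first by case/andP: t01.
    by rewrite ler_wpM2r ?expR_ge0// lerDr mulr_ge0.
  rewrite yE// (le_trans (normcB _ _))//.
  have := dint_contraction bq by_ t01 qM IH; rewrite -/L => le1.
  rewrite (le_trans (lerD (re _ t01) le1))// exprS.
  have eE : e <= e * expR (L * t) by rewrite ler_peMr// LE1//; case/andP: t01.
  rewrite (le_trans (lerD eE (lexx _)))// le_eqVlt; apply/orP; left; apply/eqP.
  by field; rewrite expf_neq0.
rewrite -subr_le0; apply: (@geometric_squeeze _ _ (N * expR L)) => n.
have := iter_le n _ x01; case/andP: x01 => x0 x1.
have LL : expR (L * x) <= expR L by rewrite ler_expR ler_piMr.
have c0 : 0 <= 2 * e + N / 2 ^+ n by rewrite addr_ge0 ?mulr_ge0 ?invr_ge0 ?exprn_ge0.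
move=> /le_trans /(_ (ler_wpM2l c0 LL)) h.
rewrite lerBlDr (le_trans h)// le_eqVlt; apply/orP; left; apply/eqP.
by ring.
Qed.

End volterra.

(** * The initial value problem y'' + q y = 0 *)

Section initial_value_problem.
Context {R : realType}.
Implicit Types (q y z : R -> R[i]) (x e M : R) (c d k : R[i]).

(** The derivative y1 of y is part of the data, which spares differentiation. *)
Definition ivp q c d y y1 :=
  [/\ primitive y y1, primitive y1 (fun x => - (q x * y x)), y 0 = c & y1 0 = d].

Lemma ivp_volterra q c d y y1 : cbmeas q -> ivp q c d y y1 ->
  volterra q (fun x => c + d * x%:C) y.
Proof.
move=> bq [py py1 y0 y10]; split; first exact: primitive_cbmeas py.
have by_ := primitive_cbmeas py; have bqy := cbmeasM bq by_.
have bi := cbmeas_cint bqy.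
move=> x /andP[x0 x1]; have [_ yE] := py; have [_ y1E] := py1.
rewrite (yE x) ?x0// y0 -addrA; congr (_ + _).
rewrite -[x in d * x%:C]subr0 -cint_cst// /dint -cintB//; last exact: cbmeas_cst.
apply: eq_cint => // s /andP[s0 sx]; have s1 := le_trans sx x1.
by rewrite (y1E s) ?s0// y10 cintN.
Qed.

Lemma ivp_exists q c d : cbmeas q -> exists y y1, ivp q c d y y1.
Proof.
move=> bq.
have pr : primitive (fun x => c + d * x%:C) (fun=> d).
  split; first exact: cbmeas_cst.
  by move=> x /andP[x0 x1]; rewrite cint_cst// mulr0 addr0 subr0.
have [y [by_ yE]] := volterra_exists bq (primitive_cbmeas pr).
have bqy := cbmeasM bq by_; have bi := cbmeas_cint bqy.
have y0 : y 0 = c.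
  by rewrite yE ?lexx ?ler01// /dint cint_point subr0 mulr0 addr0.
exists y, (fun x => d - cint 0 x (fun t => q t * y t)); split => //.
- split; first exact: cbmeasB (cbmeas_cst _) bi.
  move=> x /andP[x0 x1]; rewrite cintB//; last exact: cbmeas_cst.
  by rewrite cint_cst// subr0 yE ?x0// y0 addrA.
- split; first exact: cbmeasN.
  by move=> x /andP[x0 x1]; rewrite cintN// cint_point subr0.
- by rewrite cint_point subr0.
Qed.

Lemma ivp_scale k q c d y y1 : ivp q c d y y1 ->
  ivp q (k * c) (k * d) (fun x => k * y x) (fun x => k * y1 x).
Proof.
move=> [[b1 yE] [b2 y1E] <- <-]; split => //.
- split; first exact: cbmeasZ.
  by move=> x /andP[x0 x1]; rewrite cintZ// -mulrDr -yE ?x0.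
- split.
    have := cbmeasZ k b2; apply: eq_cbmeas => x _; ring.
  move=> x /andP[x0 x1]; rewrite y1E ?x0// mulrDr -cintZ//; congr (_ + _).
  by apply: eq_cint => // t _; ring.
Qed.

Lemma ivp_unique q c d y y1 z z1 : cbmeas q -> ivp q c d y y1 ->
  ivp q c d z z1 -> forall x, 0 <= x <= 1 -> y x = z x /\ y1 x = z1 x.
Proof.
move=> bq iy iz.
have [by_ yE] := ivp_volterra bq iy; have [bz zE] := ivp_volterra bq iz.
have [M M0 qM] := cbmeas_bounded bq; have [K K0 HK] := volterra_bound M0.
have yz x : 0 <= x <= 1 -> y x = z x.
  move=> x01; apply/eqP; rewrite -subr_eq0 -normc_eq0 eq_le normc_ge0 andbT.
  have vd : volterra q (fun=> 0) (fun t => y t - z t).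
    split; first exact: cbmeasB.
    move=> t t01; rewrite (dintBr bq by_ bz t01) (yE t t01) (zE t t01).
    by move: (dint q y t) (dint q z t) => u v; ring.
  have r0 (t : R) : 0 <= t <= 1 -> normc (0 : R[i]) <= 0 by rewrite normc0.
  have := HK q _ _ 0 bq qM vd r0 x x01.
  by rewrite mulr0.
move=> x x01; split; first exact: yz.
have [_ [_ y1E] _ y10] := iy; have [_ [_ z1E] _ z10] := iz.
rewrite y1E// z1E// y10 z10; congr (_ + _); case/andP: x01 => x0 x1.
by apply: eq_cint => // t /andP[t0 tx]; rewrite yz// t0 (le_trans tx).
Qed.

(** The difference of two solutions satisfies the Volterra equation of the first
    one, with a source of the size of q - q', to which Gronwall's inequality
    applies. *)
Lemma ivp_stable M : 0 <= M -> exists2 K, 0 <= K & forall q q' y y1 z z1,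
  cbmeas q -> cbmeas q' ->
  (forall x, 0 <= x <= 1 -> normc (q x) <= M) ->
  (forall x, 0 <= x <= 1 -> normc (q' x) <= M) ->
  ivp q 1 0 y y1 -> ivp q' 1 0 z z1 ->
  (forall x, 0 <= x <= 1 -> normc (y x) <= K) /\
  forall e, (forall x, 0 <= x <= 1 -> normc (q x - q' x) <= e) ->
    forall x, 0 <= x <= 1 -> normc (y x - z x) <= K * e.
Proof.
move=> M0; have [K K0 HK] := volterra_bound M0.
have Kle q y y1 : cbmeas q -> (forall x, 0 <= x <= 1 -> normc (q x) <= M) ->
    ivp q 1 0 y y1 -> forall x, 0 <= x <= 1 -> normc (y x) <= K.
  move=> bq qM /(ivp_volterra bq) vy x x01.
  rewrite -[K]mulr1; apply: (HK _ _ _ 1 bq qM vy) => // t _.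
  by rewrite mul0r addr0 normc1.
exists (K * (4 * K) + K); first by rewrite addr_ge0 ?mulr_ge0.
move=> q q' y y1 z z1 bq bq' qM q'M iy iz; split.
  by move=> x x01; rewrite (le_trans (Kle _ _ _ bq qM iy x x01))// lerDr !mulr_ge0.
move=> e qe x x01; have e0 : 0 <= e by rewrite (le_trans _ (qe x x01))// normc_ge0.
have [by_ yE] := ivp_volterra bq iy; have [bz zE] := ivp_volterra bq' iz.
have bqq := cbmeasB bq bq'.
apply: (@le_trans _ _ (K * (4 * (e * K)))); last first.
  have -> : K * (4 * (e * K)) = K * (4 * K) * e by ring.
  by rewrite [leRHS]mulrDl lerDl mulr_ge0.
pose r t := - dint (fun s => q s - q' s) z t.
have vd : volterra q r (fun t => y t - z t).
  split; first exact: cbmeasB.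
  move=> t t01.
  rewrite /r (dintBr bq by_ bz t01) (dintBl bq bq' bz t01) (yE t t01) (zE t t01).
  by move: (dint q y t) (dint q' z t) (dint q z t) => u v w; ring.
have re t : 0 <= t <= 1 -> normc (r t) <= 4 * (e * K).
  move=> t01; rewrite /r normcN dint_le// ?mulr_ge0// => s s01.
  by rewrite ler_pM ?normc_ge0 ?qe// (Kle _ _ _ bq' q'M iz).
exact: (HK q r _ _ bq qM vd re x x01).
Qed.

(** The derivative of the Wronskian y z' - y' z is (q - q') y z. *)
Lemma ivp_wronskian q q' c d c' d' y y1 z z1 x :
  cbmeas q -> cbmeas q' -> ivp q c d y y1 -> ivp q' c' d' z z1 -> 0 <= x <= 1 ->
  y x * z1 x - y1 x * z x =
    c * d' - d * c' + cint 0 x (fun t => (q t - q' t) * (y t * z t)).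
Proof.
move=> bq bq' [py py1 <- <-] [pz pz1 <- <-] /andP[x0 x1].
have [bY YE] := primitiveM py pz1; have [bZ ZE] := primitiveM py1 pz.
rewrite YE ?x0// ZE ?x0// opprD addrACA -cintB//; congr (_ + _).
by apply: eq_cint => // t _; ring.
Qed.

(** The Wronskian with the solution z such that z(0) = 0 and z'(0) = 1 is 1. *)
Lemma ivp_no_common_zero q y y1 x : cbmeas q -> ivp q 1 0 y y1 -> 0 <= x <= 1 ->
  y x = 0 -> y1 x != 0.
Proof.
move=> bq iy x01 yx0; have [z [z1 iz]] := ivp_exists 0 1 bq.
apply/eqP => y1x0; have := ivp_wronskian bq bq iy iz x01.
rewrite yx0 y1x0 !mul0r subrr mulr1 subr0.
under [X in cint _ _ X]eq_fun do rewrite subrr mul0r.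
rewrite cint_cst; last by case/andP: x01.
by rewrite mul0r addr0 => /esym/eqP; rewrite oner_eq0.
Qed.

Lemma cint_conj a b (f : R -> R[i]) : cbmeas f -> 0 <= a -> b <= 1 ->
  cint a b (fun x => conjc (f x)) = conjc (cint a b f).
Proof.
move=> [rf jf] a0 b1; apply: eqc.
  rewrite Re_cint; transitivity (complex.Re (cint a b f)); last by case: (cint _ _ _).
  by rewrite Re_cint; apply: eq_rint => // x _; case: (f x).
rewrite Im_cint; transitivity (- complex.Im (cint a b f)); last by case: (cint _ _ _).
rewrite Im_cint -mulN1r -rintZ//.
by apply: eq_rint => // x _; case: (f x) => ? ? /=; rewrite mulN1r.
Qed.

Lemma cbmeas_conj (f : R -> R[i]) : cbmeas f -> cbmeas (fun x => conjc (f x)).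
Proof.
move=> [rf jf]; split; first by apply: eq_bmeas rf => x _; case: (f x).
by apply: eq_bmeas (bmeasN jf) => x _; case: (f x).
Qed.

Lemma ivp_conj q c d y y1 : ivp q c d y y1 ->
  ivp (fun x => conjc (q x)) (conjc c) (conjc d)
    (fun x => conjc (y x)) (fun x => conjc (y1 x)).
Proof.
move=> [[b1 yE] [b2 y1E] <- <-]; split => //.
- split; first exact: cbmeas_conj.
  by move=> x /andP[x0 x1]; rewrite cint_conj// -rmorphD -yE ?x0.
- have E t : - (conjc (q t) * conjc (y t)) = conjc (- (q t * y t)).
    by rewrite rmorphN rmorphM.
  split; first by apply: eq_cbmeas (cbmeas_conj b2) => x _.
  move=> x /andP[x0 x1]; rewrite y1E ?x0// rmorphD; congr (_ + _).
  rewrite -[LHS](cint_conj b2)//.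
  by apply: eq_cint => // t _; rewrite E.
Qed.

Lemma sqr_normc_ReIm c : normc c ^+ 2 = complex.Re c ^+ 2 + complex.Im c ^+ 2.
Proof. by case: c => a b; rewrite sqr_sqrtr// addr_ge0 ?sqr_ge0. Qed.

Lemma bmeas_sqr_normc y : cbmeas y -> bmeas (fun x => normc (y x) ^+ 2).
Proof.
move=> [ry jy]; apply: eq_bmeas (bmeasD (bmeasM ry ry) (bmeasM jy jy)) => x _.
by rewrite sqr_normc_ReIm !expr2.
Qed.

(** Im (conj y y') measures how fast y rotates about the origin; 2i times it is
    the Wronskian of conj y and y, and conj y solves the equation with
    coefficient conj q. *)
Lemma ivp_rotation q y y1 x : cbmeas q -> ivp q 1 0 y y1 -> 0 <= x <= 1 ->
  complex.Im (conjc (y x) * y1 x) =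
  - rint 0 x (fun t => complex.Im (q t) * normc (y t) ^+ 2).
Proof.
move=> bq iy x01; have := ivp_wronskian (cbmeas_conj bq) bq (ivp_conj iy) iy x01.
have [py _ _ _] := iy; have by_ := primitive_cbmeas py.
have biqy : bmeas (fun t => complex.Im (q t) * normc (y t) ^+ 2).
  by apply: bmeasM (bmeas_sqr_normc by_); case: bq.
move=> /(congr1 (@complex.Im R)); rewrite cImB cImD Im_cint.
rewrite conjc0 mulr0 mul0r subrr add0r => E.
case/andP: (x01) => x0 x1.
have : 2 * complex.Im (conjc (y x) * y1 x) =
    2 * (- rint 0 x (fun t => complex.Im (q t) * normc (y t) ^+ 2)).
  rewrite mulrN -mulNr -rintZ//.
  transitivity (complex.Im (conjc (y x) * y1 x) - complex.Im (conjc (y1 x) * y x)).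
    by case: (y x) (y1 x) => ? ? [? ?] /=; ring.
  rewrite E; apply: eq_rint => // t _.
  by rewrite sqr_normc_ReIm; case: (q t) (y t) => ? ? [? ?] /=; ring.
by apply: mulfI; rewrite pnatr_eq0.
Qed.

(** Near 0 the integrand is at least b1 / 4, as y(0) = 1. *)
Lemma ivp_mass_gt0 (b : R -> R) b1 y y1 x : bmeas b -> 0 < b1 ->
  (forall t, 0 <= t <= 1 -> b1 <= b t) -> primitive y y1 -> y 0 = 1 ->
  0 < x <= 1 -> 0 < rint 0 x (fun t => b t * normc (y t) ^+ 2).
Proof.
move=> bb b10 b1b py y0 /andP[x0 x1]; have by_ := primitive_cbmeas py.
have [M M0 yM] := primitive_lipschitz py.
have M1 : 0 < 2 * (M + 1) by lra.
pose e := Num.min x (2 * (M + 1))^-1.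
have e0 : 0 < e by rewrite lt_min x0 invr_gt0.
have ex : e <= x by rewrite ge_min lexx.
have eM : e * (2 * (M + 1)) <= 1.
  by rewrite -ler_pdivlMr// mul1r ge_min lexx orbT.
have bm := bmeasM bb (bmeas_sqr_normc by_).
rewrite (rint_split bm _ (ltW e0))//.
have tail : 0 <= rint e x (fun t => b t * normc (y t) ^+ 2).
  apply: rint_ge0 => t /andP[et tx].
  rewrite mulr_ge0 ?exprn_ge0 ?normc_ge0// (le_trans (ltW b10))// b1b//.
  by rewrite (le_trans (ltW e0) et) (le_trans tx).
rewrite ltr_pwDl// (@lt_le_trans _ _ (b1 * 2^-1 ^+ 2 * (e - 0)))//.
  by rewrite subr0 !mulr_gt0 ?exprn_gt0 ?invr_gt0.
rewrite -rint_cst ?(ltW e0)// ler_rint//; first exact: bmeas_cst.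
  exact: le_trans x1.
move=> t /andP[t0 te]; have t1 : t <= 1 by rewrite (le_trans te)// (le_trans ex).
rewrite ler_pM ?(ltW b10) ?exprn_ge0 ?invr_ge0 ?b1b ?t0//.
rewrite ler_pXn2r ?nnegrE ?normc_ge0 ?invr_ge0//.
have := yM 0 t (lexx _) t0 t1; rewrite y0 subr0 => yt.
have : normc (y t - (y t - 1)) <= normc (y t) + normc (y t - 1) by exact: normcB.
rewrite subKr normc1.
have : M * t <= M * e by rewrite ler_wpM2l.
by lra.
Qed.

End initial_value_problem.

(** * Essentially bounded functions *)

Section essentially_bounded.
Context {R : realType}.
Implicit Types (f g B : R -> R) (y : R -> R[i]) (a b x : R) (P Q : R -> Prop).
Notation mu := (@lebesgue_measure R).

Lemma aeS P Q : (forall x, P x -> Q x) ->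
  {ae mu, forall x, P x} -> {ae mu, forall x, Q x}.
Proof. exact: (@filterS _ _ (ae_filter_ringOfSetsType mu)). Qed.

Lemma aeI P Q : {ae mu, forall x, P x} -> {ae mu, forall x, Q x} ->
  {ae mu, forall x, P x /\ Q x}.
Proof. exact: (@filterI _ _ (ae_filter_ringOfSetsType mu)). Qed.

Lemma ae_neq a : {ae mu, forall x, x != a}.
Proof.
exists [set a]; split => //; first exact: lebesgue_measure_set1.
by move=> x /= /negP; rewrite negbK => /eqP.
Qed.

Lemma ae01_closed P : ae01 P -> {ae mu, forall x, 0 <= x <= 1 -> P x}.
Proof.
move=> aeP; apply: aeS (aeI (aeI (ae_neq 0) (ae_neq 1)) aeP).
move=> x [[x0 x1] Px] /andP[le0 le1]; apply: Px.
by rewrite in_itv/= !lt_neqAle eq_sym x0 x1 le0.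
Qed.

Lemma ae01S P Q : (forall x, x \in `]0, 1[ -> P x -> Q x) -> ae01 P -> ae01 Q.
Proof. by move=> PQ; apply: aeS => x Px x01; apply: PQ => //; exact: Px. Qed.

Lemma ae01I P Q : ae01 P -> ae01 Q -> ae01 (fun x => P x /\ Q x).
Proof.
move=> aeP aeQ; apply: aeS (aeI aeP aeQ) => x [Px Qx] x01.
by split; [exact: Px|exact: Qx].
Qed.

Lemma measurable01 f : measurable_fun (`]0, 1[ : set R) f ->
  measurable_fun (`[0, 1] : set R) f.
Proof.
move=> mf; apply/measurable_fun_itv_bndo_bndcP.
exact/measurable_fun_itv_obnd_cbndP.
Qed.

Lemma ae_eq_rint f g x : measurable_fun (`]0, 1[ : set R) f ->
  measurable_fun (`]0, 1[ : set R) g -> ae01 (fun t => f t = g t) ->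
  0 <= x <= 1 -> rint 0 x f = rint 0 x g.
Proof.
move=> /measurable01 mf /measurable01 mg fg /andP[x0 x1].
have sub : `[0, x] `<=` (`[0, 1] : set R) by apply: subset_itv; rewrite bnd_simp.
rewrite /rint /Rintegral; congr fine; apply: ae_eq_integral => //.
- by apply/measurable_EFinP; exact: measurable_funS mf.
- by apply/measurable_EFinP; exact: measurable_funS mg.
apply: aeS (ae01_closed fg) => t fgt /=; rewrite in_itv/= => /andP[t0 tx].
by rewrite fgt// t0 (le_trans tx).
Qed.

Definition clamp a b f x := Num.max a (Num.min b (f x)).

Lemma clamp_itv a b f x : a <= b -> a <= clamp a b f x <= b.
Proof. by move=> ab; rewrite /clamp le_max lexx ge_max ab ge_min lexx. Qed.

Lemma clamp_id a b f x : a <= f x <= b -> clamp a b f x = f x.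
Proof. by move=> /andP[af fb]; rewrite /clamp min_r// max_r. Qed.

Lemma bmeas_clamp a b f : a <= b -> measurable_fun (`]0, 1[ : set R) f ->
  bmeas (clamp a b f).
Proof.
move=> ab mf; split.
  apply: measurable01; apply: measurable_maxr => //; exact: measurable_minr.
exists (Num.max `|a| `|b|) => x _; have /andP[h1 h2] := clamp_itv f x ab.
rewrite ler_norml; apply/andP; split.
  rewrite (le_trans _ h1)// lerNl le_max.
  by rewrite (le_trans (ler_norm _))// normrN.
by rewrite (le_trans h2)// le_max orbC ler_norm.
Qed.

Lemma bmeas_measurable f : bmeas f -> measurable_fun (`]0, 1[ : set R) f.
Proof.
move=> [mf _]; apply: measurable_funS mf => //.
by apply: subset_itv; rewrite bnd_simp.
Qed.

Lemma Linfty01_bmeas f : Linfty01 f ->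
  exists2 g, bmeas g & ae01 (fun x => f x = g x).
Proof.
move=> [mf [M fM]]; exists (clamp (- `|M|) `|M| f).
  by apply: bmeas_clamp => //; rewrite (@le_trans _ _ 0)// oppr_le0.
apply: ae01S fM => x _ fx; rewrite clamp_id// -ler_norml.
by rewrite (le_trans fx)// ler_norm.
Qed.

Lemma cLinfty01_cbmeas y : cLinfty01 y ->
  exists2 z, cbmeas z & ae01 (fun x => y x = z x).
Proof.
move=> [/Linfty01_bmeas[u bu yu] /Linfty01_bmeas[v bv yv]].
exists (fun x => u x +i* v x) => //.
by apply: ae01S (ae01I yu yv) => x _ [? ?]; apply: eqc.
Qed.

Lemma ae_eq_cint (y z : R -> R[i]) x : cLinfty01 y -> cbmeas z ->
  ae01 (fun t => y t = z t) -> 0 <= x <= 1 -> cint 0 x y = cint 0 x z.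
Proof.
move=> [[mry _] [mjy _]] [rz jz] yz x01; apply: eqc; rewrite ?Re_cint ?Im_cint.
  apply: ae_eq_rint => //; first exact: bmeas_measurable.
  by apply: ae01S yz => t _ ->.
apply: ae_eq_rint => //; first exact: bmeas_measurable.
by apply: ae01S yz => t _ ->.
Qed.

Lemma bmeas_Linfty01 f : bmeas f -> Linfty01 f.
Proof.
move=> bf; split; first exact: bmeas_measurable.
case: bf => _ [M fM]; exists M; apply: aeW => x.
by rewrite in_itv/= => /andP[x0 x1]; rewrite fM// !ltW.
Qed.

(** Truncation does not change B almost everywhere, and makes the bounds hold at
    every point. *)
Lemma Ad_representative b1 b2 B : b1 <= b2 -> Ad b1 b2 B -> exists B',
  [/\ bmeas B', forall x, b1 <= B' x <= b2 & ae01 (fun x => B x = B' x)].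
Proof.
move=> b12 [[mB _] B12]; exists (clamp b1 b2 B); split.
- exact: bmeas_clamp.
- by move=> x; exact: clamp_itv.
- by apply: ae01S B12 => x _ Bx; rewrite clamp_id.
Qed.

Lemma Ad_bmeas b1 b2 B : bmeas B ->
  (forall x, 0 <= x <= 1 -> b1 <= B x <= b2) -> Ad b1 b2 B.
Proof.
move=> bB B12; split; first exact: bmeas_Linfty01.
by apply: aeW => x; rewrite in_itv/= => /andP[x0 x1]; rewrite B12// !ltW.
Qed.

Lemma rint_eq0_ae f : bmeas f -> (forall x, 0 <= x <= 1 -> 0 <= f x) ->
  rint 0 1 f <= 0 -> ae01 (fun x => f x = 0).
Proof.
move=> bf f0 If; have intf := bmeas_integrable bf (lexx 0) (lexx 1).
have I0 : rint 0 1 f = 0 by apply/eqP; rewrite eq_le If rint_ge0.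
have [mf _] := bf.
have /ae_eq_integral_abs : (\int[mu]_(x in `[0%R, 1%R]) `|(f x)%:E| = 0)%E.
  rewrite (_ : (\int[mu]_(x in `[0%R, 1%R]) `|(f x)%:E|)%E =
               (\int[mu]_(x in `[0%R, 1%R]) (f x)%:E)%E); last first.
    apply: eq_integral => x; rewrite inE/= in_itv/= => x01.
    by rewrite ger0_norm ?f0.
  rewrite -[LHS]fineK; last exact: integrable_fin_num.
  by congr (_%:E); exact: I0.
move=> h.
have : {ae mu, forall x, x \in `[0, 1] -> (f x)%:E = 0%E}.
  by apply: h => //; exact/measurable_EFinP.
apply: aeS => x fx; rewrite in_itv/= => /andP[x0 x1].
by have [] : (f x)%:E = 0%E by apply: fx; rewrite /= in_itv/= !ltW.
Qed.

End essentially_bounded.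

Section strong_solutions.
Context {R : realType}.
Implicit Types (B : R -> R) (y : R -> R[i]) (kappa : R[i]).

Definition coef kappa B x : R[i] := kappa ^+ 2 * (B x)%:C.

Lemma cbmeas_coef kappa B : bmeas B -> cbmeas (coef kappa B).
Proof. by move=> bB; apply: cbmeasZ; exact: cbmeas_real. Qed.

Lemma solves_ivp B B' kappa y y1 : bmeas B' -> ae01 (fun x => B x = B' x) ->
  solves B kappa y y1 -> ivp (coef kappa B') (y 0) (y1 0) y y1.
Proof.
move=> bB' BB' [y2 [[by2 y1E yE] eq2]].
have [z2 bz2 yz2] := cLinfty01_cbmeas by2.
have itv x : (x \in `[0, 1]) = (0 <= x <= 1) by rewrite in_itv.
have py1 : primitive y1 z2.
  split => // x x01; rewrite y1E ?itv//; congr (_ + _).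
  exact: ae_eq_cint yz2 x01.
have py : primitive y y1.
  by split; [exact: primitive_cbmeas py1|move=> x x01; rewrite yE ?itv].
have bqy := cbmeasN (cbmeasM (cbmeas_coef kappa bB') (primitive_cbmeas py)).
split => //; split => // x x01; rewrite y1E ?itv//; congr (_ + _).
apply: ae_eq_cint => //; apply: ae01S (ae01I BB' eq2) => t _ [Bt /eqP].
by rewrite addr_eq0 => /eqP ->; rewrite /coef Bt.
Qed.

Lemma ivp_solves B kappa c d y y1 : bmeas B -> ivp (coef kappa B) c d y y1 ->
  solves B kappa y y1.
Proof.
move=> bB [[b1 yE] [b2 y1E] _ _]; exists (fun x => - (coef kappa B x * y x)).
have itv x : (x \in `[0, 1]) = (0 <= x <= 1) by rewrite in_itv.
split; last by apply: aeW => x _; rewrite addrC subrr.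
split; first by case: b2 => ? ?; split; exact: bmeas_Linfty01.
  by move=> x; rewrite itv; exact: y1E.
by move=> x; rewrite itv; exact: yE.
Qed.

End strong_solutions.

(** * Moving a quasi-eigenvalue *)

Section convex_cone.
Context {R : realType}.
Implicit Types (K : set R[i]) (d w : R[i]).

Definition convex_cone K :=
  (forall d d', K d -> K d' -> K (d + d')) /\
  (forall (r : R) d, 0 < r -> K d -> K (r%:C * d)).

(** The slopes Re d / Im d of the points of K above the real axis stay below
    those of the points under it, for otherwise a positive combination of two
    such points would be a positive real.  A slope in between gives w. *)
Lemma separation_from_1 K : convex_cone K -> ~ K 1 ->
  exists2 w, w != 0 & forall d, K d -> complex.Re (w * d) <= 0.
Proof.
move=> [KD KZ] nK1.
have real r : K r%:C -> r <= 0.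
  move=> Kr; rewrite leNgt; apply/negP => r0; apply: nK1.
  have := KZ r^-1 _ _ Kr; rewrite invr_gt0 => /(_ r0).
  by rewrite -rmorphM mulVf ?gt_eqF.
have [up|noup] := pselect (exists d, K d /\ 0 < complex.Im d); last first.
  exists (0 -i* 1); first by rewrite eq_complex /= oppr_eq0 oner_eq0 andbF.
  move=> [x y] Kd /=; rewrite mul0r sub0r mulN1r opprK leNgt.
  by apply/negP => y0; apply: noup; exists (x +i* y).
have [down|nodown] := pselect (exists d, K d /\ complex.Im d < 0); last first.
  exists 'i%C; first by rewrite eq_complex /= oner_eq0 andbF.
  move=> [x y] Kd /=; rewrite mul0r sub0r mul1r oppr_le0 leNgt.
  by apply/negP => y0; apply: nodown; exists (x +i* y).
pose S := [set complex.Re d / complex.Im d | d in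
  [set d | K d /\ 0 < complex.Im d]].
have Sle d : K d -> complex.Im d < 0 -> ubound S (complex.Re d / complex.Im d).
  move=> Kd d0 _ [d' [Kd' d'0] <-].
  have := KD _ _ (KZ _ _ d'0 Kd) (KZ (- complex.Im d) _ _ Kd').
  rewrite oppr_gt0 => /(_ d0).
  case: d d' d0 d'0 {Kd Kd'} => [x y] [x' y'] /= y0 y'0.
  rewrite (_ : _ + _ = (y' * x - y * x')%:C); last by apply: eqc; rewrite /=; ring.
  move=> /real; rewrite subr_le0 => le_yx.
  by rewrite ler_pdivrMr// mulrAC ler_ndivlMr// mulrC [x' * y]mulrC.
have hasS : has_sup S.
  case: up => d [Kd d0]; case: down => d' [Kd' d'0].
  split; first by exists (complex.Re d / complex.Im d), d.
  by exists (complex.Re d' / complex.Im d'); exact: Sle.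
exists (1 +i* sup S); first by rewrite eq_complex /= oner_eq0.
move=> d Kd; rewrite cReM /= mul1r subr_le0.
case: (ltrgtP (complex.Im d) 0) => [d0|d0|d0].
- rewrite -ler_ndivlMr//; apply: ge_sup; first by case: hasS.
  exact: Sle.
- rewrite -ler_pdivrMr//; apply: ub_le_sup; first by case: hasS.
  by exists d.
- rewrite d0 mulr0; apply: real; move: Kd d0.
  by case: d => x y /= + y0; rewrite y0.
Qed.

Lemma separation K e : convex_cone K -> e != 0 -> ~ K e ->
  exists2 w, w != 0 & forall d, K d -> complex.Re (w * d) <= 0.
Proof.
move=> [KD KZ] e0 nKe.
have [||w w0 wK] := @separation_from_1 [set d | K (d * e)].
- split=> [d d' Kd Kd'|r d r0 Kd] /=; first by rewrite mulrDl; exact: KD.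
  by rewrite -mulrA; exact: KZ.
- by rewrite /= mul1r.
exists (w / e); first by rewrite mulf_neq0 ?invr_eq0.
by move=> d Kd; rewrite mulrAC -mulrA; apply: wK; rewrite /= divfK.
Qed.

End convex_cone.

Lemma normc_cint01 {R : realType} (f : R -> R[i]) (N : R) : cbmeas f ->
  (forall x, 0 <= x <= 1 -> normc (f x) <= N) -> normc (cint 0 1 f) <= 2 * N.
Proof.
move=> bf fN; have := normc_cint_cst bf (lexx 0) ler01 (lexx 1) fN.
by rewrite subr0 mulr1.
Qed.

(** A map with values O(s^2) and Lipschitz constant O(s) on the disc of radius s
    has a fixed point there once s is small: the form in which a zero that is
    nondegenerate in the parameters survives a perturbation. *)
Lemma small_contraction {R : realType} (G : R[i] -> R[i]) (s c : R) :
  0 <= s -> s * c <= 2^-1 ->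
  (forall w, normc w <= s -> normc (G w) <= s * (s * c)) ->
  (forall w w', normc w <= s -> normc w' <= s ->
    normc (G w - G w') <= s * c * normc (w - w')) ->
  exists2 w, normc w <= s & G w = w.
Proof.
move=> s0 sc Gs Gc.
pose P := [set f : unit -> R[i] | normc (f tt) <= s].
have [|||||f Pf fE] := @weighted_contraction R unit setT (fun=> 1) P
    (fun f _ => G (f tt)) (fun=> 0).
- move=> h f M Ph hf; rewrite /P /= -subr_le0.
  apply: (@geometric_squeeze _ _ M) => n; rewrite lerBlDr.
  rewrite -[f tt](subrK (h n tt)) (le_trans (le_normcD _ _))//.
  by rewrite distcC lerD//; [have := hf n tt I; rewrite mulr1|exact: Ph].
- move=> f Pf; rewrite /P /= (le_trans (Gs _ Pf))// ler_piMr//.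
  by rewrite (le_trans sc)// invf_le1 ?ler1n.
- move=> f f' e Pf Pf' fe [] _; rewrite mulr1.
  have := fe tt I; rewrite mulr1 => fe'.
  rewrite (le_trans (Gc _ _ Pf Pf'))//.
  by rewrite (le_trans (ler_wpM2r (normc_ge0 _) sc))// mulrC ler_wpM2r.
- by rewrite /P /mkset normc0.
- by exists (normc (G 0)) => -[] _; rewrite mulr1 subr0.
by exists (f tt) => //; exact: fE.
Qed.

Section perturbation.
Context {R : realType} (B V1 V2 V3 : R -> R) (b A : R).
Context (kappa : R[i]) (phi phi1 : R -> R[i]).
Hypothesis bB : bmeas B.
Hypothesis B_le : forall x, 0 <= x <= 1 -> `|B x| <= b.
Hypothesis bV1 : bmeas V1.
Hypothesis bV2 : bmeas V2.
Hypothesis bV3 : bmeas V3.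
Hypothesis V_le : forall x, 0 <= x <= 1 -> `|V1 x| + `|V2 x| + `|V3 x| <= A.
Hypothesis kappa0 : kappa != 0.
Hypothesis iphi : ivp (coef kappa B) 1 0 phi phi1.
Hypothesis bc_phi : phi1 1 = - 'i%C * kappa * phi 1.

(** Below, V1, V2 and V3 are directions whose first variations
    \int phi^2 V are 1, i and -1 - i.  Then w is the first variation of
    combo s w, whose three coefficients are nonnegative when |w| <= s: admissible
    increments are parametrized affinely by a disc. *)
Definition combo s (w : R[i]) x :=
  (s + complex.Re w) * V1 x + (s + complex.Im w) * V2 x + s * V3 x.

Lemma bmeas_combo s w : bmeas (combo s w).
Proof. by do !(apply: bmeasD || apply: bmeasM => // || exact: bmeas_cst). Qed.

Lemma combo_le s w x : 0 <= x <= 1 -> normc w <= s -> `|combo s w x| <= 2 * s * A.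
Proof.
move=> x01 ws; have := V_le x01.
have s0 : 0 <= s by rewrite (le_trans _ ws)// normc_ge0.
have h1 := le_trans (normr_Re w) ws; have h2 := le_trans (normr_Im w) ws.
move=> VA; rewrite (@le_trans _ _ (2 * s * (`|V1 x| + `|V2 x| + `|V3 x|)))//.
  have bd (a v : R) : `|a| <= s -> `|(s + a) * v| <= 2 * s * `|v|.
    move=> as_; rewrite normrM ler_wpM2r// (le_trans (ler_normD _ _))//.
    by rewrite (ger0_norm s0); lra.
  rewrite !mulrDr (le_trans (ler_normD _ _))// lerD//.
    by rewrite (le_trans (ler_normD _ _))// lerD// bd.
  by have := bd 0 (V3 x); rewrite addr0 normr0 => /(_ s0).
by rewrite ler_wpM2l// mulr_ge0.
Qed.

Lemma combo_lip s w w' x : 0 <= x <= 1 ->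
  `|combo s w x - combo s w' x| <= A * normc (w - w').
Proof.
move=> x01; have -> : combo s w x - combo s w' x =
    complex.Re (w - w') * V1 x + complex.Im (w - w') * V2 x.
  by rewrite cReB cImB /combo; ring.
have n0 := normc_ge0 (w - w').
apply: (@le_trans _ _ (normc (w - w') * (`|V1 x| + `|V2 x|))).
  rewrite (le_trans (ler_normD _ _))// mulrDr !normrM.
  by rewrite lerD// ler_wpM2r// ?normr_Re ?normr_Im.
rewrite mulrC ler_wpM2r// (le_trans _ (V_le x01))//.
by rewrite lerDl.
Qed.

Lemma cint_combo s w :
  cint 0 1 (fun x => phi x ^+ 2 * (V1 x)%:C) = 1 ->
  cint 0 1 (fun x => phi x ^+ 2 * (V2 x)%:C) = 'i%C ->
  cint 0 1 (fun x => phi x ^+ 2 * (V3 x)%:C) = - 1 - 'i%C ->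
  cint 0 1 (fun x => phi x ^+ 2 * (combo s w x)%:C) = w.
Proof.
move=> e1 e2 e3; have [pphi _ _ _] := iphi; have bphi := primitive_cbmeas pphi.
have bp V : bmeas V -> cbmeas (fun x => phi x ^+ 2 * (V x)%:C).
  by move=> bV; apply: cbmeasM; [exact: cbmeasM|exact: cbmeas_real].
transitivity (cint 0 1 (fun x => (s + complex.Re w)%:C * (phi x ^+ 2 * (V1 x)%:C) +
   (s + complex.Im w)%:C * (phi x ^+ 2 * (V2 x)%:C) +
   s%:C * (phi x ^+ 2 * (V3 x)%:C))).
  apply: eq_cint => // x _; rewrite /combo !rmorphD !rmorphM/= !rmorphD/=.
  by move: (phi x) (V1 x)%:C (V2 x)%:C (V3 x)%:C => p v1 v2 v3; ring.
have b1 := bp _ bV1; have b2 := bp _ bV2; have b3 := bp _ bV3.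
have := cintD (cbmeasD (cbmeasZ _ b1) (cbmeasZ _ b2)) (cbmeasZ _ b3)
  (lexx 0) (lexx 1).
move=> ->; rewrite (cintD (cbmeasZ _ b1) (cbmeasZ _ b2) (lexx 0) (lexx 1)).
rewrite !cintZ// e1 e2 e3; apply: eqc; case: w => x y /=; ring.
Qed.

(** phi solves y'' + kappa^2 B y = 0 and satisfies the outgoing boundary
    condition at 1.  By the Wronskian identity, the solution y for z and
    B + combo s w satisfies that condition for z as soon as
      z^2 \int combo phi y = (kappa^2 - z^2) \int B phi y
                             - i (kappa - z) phi(1) y(1).
    As \int combo phi^2 = w, this is a fixed-point equation for w whose right-hand
    side is a contraction of the disc of radius s. *)
Lemma quasi_eigenvalue_moves :
  cint 0 1 (fun x => phi x ^+ 2 * (V1 x)%:C) = 1 ->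
  cint 0 1 (fun x => phi x ^+ 2 * (V2 x)%:C) = 'i%C ->
  cint 0 1 (fun x => phi x ^+ 2 * (V3 x)%:C) = - 1 - 'i%C ->
  exists2 s0, 0 < s0 & forall s z, 0 < s <= s0 -> normc (z - kappa) <= s * s ->
    exists w y y1, [/\ normc w <= s,
      ivp (coef z (fun x => B x + combo s w x)) 1 0 y y1 &
      y1 1 = - 'i%C * z * y 1].
Proof.
move=> e1 e2 e3.
have [pphi _ _ _] := iphi; have bphi := primitive_cbmeas pphi.
have le01 : 0 <= (0 : R) <= 1 by rewrite lexx ler01.
have le11 : 0 <= (1 : R) <= 1 by rewrite lexx ler01.
have A0 : 0 <= A.
  by rewrite (le_trans _ (V_le le01))// !addr_ge0.
have b0 : 0 <= b by rewrite (le_trans _ (B_le le01)).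
have nk : 0 < normc kappa by rewrite normc_gt0.
have [Z ZE] : {Z : R | Z = normc kappa + 1} by exists (normc kappa + 1).
have Z0 : 0 <= Z by rewrite ZE addr_ge0 ?normc_ge0.
(* M bounds the coefficients of all the equations, K is the stability constant
   for that bound.  Up to powers of s, c1 bounds the distance of the coefficients
   to the original one, cE the functional E, c2 the values of the map G and c3 its
   Lipschitz constant. *)
have [M ME] : {M : R | M = Z ^+ 2 * (b + 2 * A)} by exists (Z ^+ 2 * (b + 2 * A)).
have M0 : 0 <= M by rewrite ME !(mulr_ge0, addr_ge0, exprn_ge0).
have [K K0 HK] := ivp_stable M0.
have [cz czE] : {cz : R | cz = 4 / normc kappa ^+ 2} by exists (4 / normc kappa ^+ 2).
have cz0 : 0 <= cz by rewrite czE divr_ge0 ?exprn_ge0 ?normc_ge0.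
have [cE cEE] : {cE : R | cE =
    cz * (2 * Z * (2 * (b * K)) + K)} by eexists.
have cE0 : 0 <= cE by rewrite cEE !(mulr_ge0, addr_ge0).
have [c1 c1E] : {c1 : R | c1 =
    2 * Z * b + 2 * Z ^+ 2 * A} by eexists.
have c10 : 0 <= c1 by rewrite c1E !(mulr_ge0, addr_ge0, exprn_ge0).
have [c2 c2E] : {c2 : R | c2 =
    cE * K + 4 * A * K ^+ 2 * c1} by eexists.
have c20 : 0 <= c2 by rewrite c2E !(mulr_ge0, addr_ge0, exprn_ge0).
have [c3 c3E] : {c3 : R | c3 =
    cE * K * Z ^+ 2 * A + 2 * A * K ^+ 2 * c1 + 4 * A ^+ 2 * K ^+ 2 * Z ^+ 2} by eexists.
have c30 : 0 <= c3 by rewrite c3E !(mulr_ge0, addr_ge0, exprn_ge0).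
pose c := c2 + c3; have cc0 : 0 <= c by rewrite addr_ge0.
exists (Num.min 1 (Num.min (normc kappa / 2) (2 * c + 1)^-1)).
  by rewrite !lt_min ltr01 divr_gt0// invr_gt0 ltr_wpDl// mulr_ge0.
move=> s z /andP[s_gt0]; rewrite !le_min => /and3P[s1 sk sc] zk.
have s0 : 0 <= s by exact: ltW.
have sc2 : s * c <= 2^-1.
  have : s * (2 * c + 1) <= 1 by rewrite -ler_pdivlMr ?mul1r// ltr_wpDl ?mulr_ge0.
  by nra.
have zk_s : normc (z - kappa) <= s by rewrite (le_trans zk)// ler_piMl.
have zZ : normc z <= Z.
  rewrite -(subrK kappa z) addrC (le_trans (le_normcD _ _))// ZE lerD2l.
  exact: le_trans s1.
have kZ : normc kappa <= Z by rewrite ZE lerDl.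
have z_ge : normc kappa / 2 <= normc z.
  have := le_normcD (kappa - z) z; rewrite subrK distcC.
  by lra.
have z0 : z != 0 by rewrite -normc_gt0 (lt_le_trans _ z_ge)// divr_gt0.
pose zeta := (z ^+ 2)^-1.
have zeta_le : normc zeta <= cz.
  rewrite /zeta normcV expr2 normcM -expr2 czE -[4]invrK -invfM lef_pV2.
  - have -> : 4^-1 * normc kappa ^+ 2 = (normc kappa / 2) ^+ 2 by field.
    by rewrite ler_pXn2r ?nnegrE ?normc_ge0// divr_ge0 ?normc_ge0.
  - by rewrite posrE exprn_gt0// normc_gt0.
  - by rewrite posrE mulr_gt0 ?invr_gt0 ?exprn_gt0.
have zk2 : normc (kappa ^+ 2 - z ^+ 2) <= s * s * (2 * Z).
  have -> : kappa ^+ 2 - z ^+ 2 = (kappa - z) * (kappa + z) by ring.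
  rewrite normcM distcC ler_pM ?normc_ge0//.
  by rewrite (le_trans (le_normcD _ _))// mulr_natl mulr2n lerD.
pose q w := coef z (fun x => B x + combo s w x).
have bcombo w : bmeas (combo s w) by exact: bmeas_combo.
have bq w : cbmeas (q w) by apply: cbmeas_coef; exact: bmeasD.
have q_le w x : normc w <= s -> 0 <= x <= 1 -> normc (q w x) <= M.
  move=> ws x01; rewrite /q /coef expr2 !normcM -expr2 normc_real ME.
  rewrite ler_pM ?exprn_ge0 ?normc_ge0 ?normr_ge0//.
    by rewrite ler_pXn2r ?nnegrE ?normc_ge0.
  rewrite (le_trans (ler_normD _ _))// lerD ?B_le//.
  rewrite (le_trans (combo_le x01 ws))// ler_wpM2r//.
  by rewrite ler_piMr.
have q0_le x : 0 <= x <= 1 -> normc (coef kappa B x) <= M.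
  move=> x01; rewrite /coef expr2 !normcM -expr2 normc_real ME.
  rewrite ler_pM ?exprn_ge0 ?normc_ge0 ?normr_ge0//.
    by rewrite ler_pXn2r ?nnegrE ?normc_ge0.
  by rewrite (le_trans (B_le x01))// lerDl mulr_ge0.
have q_dist0 w x : normc w <= s -> 0 <= x <= 1 ->
    normc (q w x - coef kappa B x) <= s * c1.
  move=> ws x01.
  have -> : q w x - coef kappa B x =
      - (kappa ^+ 2 - z ^+ 2) * (B x)%:C + z ^+ 2 * (combo s w x)%:C.
    by rewrite /q /coef rmorphD/=; ring.
  rewrite (le_trans (le_normcD _ _))// expr2 !normcM normcN -!expr2 !normc_real.
  apply: (@le_trans _ _ (s * s * (2 * Z) * b + Z ^+ 2 * (2 * s * A))).
    rewrite lerD// ler_pM ?exprn_ge0 ?normc_ge0 ?normr_ge0 ?B_le ?combo_le//.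
    by rewrite ler_pXn2r ?nnegrE ?normc_ge0.
  have : s * s * (2 * Z) * b <= s * (2 * Z * b).
    have -> : s * s * (2 * Z) * b = s * (s * (2 * Z * b)) by ring.
    by rewrite ler_wpM2l// ler_piMl// !mulr_ge0.
  by rewrite c1E; lra.
have q_lip w w' x : 0 <= x <= 1 ->
    normc (q w x - q w' x) <= Z ^+ 2 * A * normc (w - w').
  move=> x01.
  have -> : q w x - q w' x = z ^+ 2 * (combo s w x - combo s w' x)%:C.
    rewrite /q /coef rmorphB (rmorphD _ (B x)) (rmorphD _ (B x)) -mulrBr.
    by congr (_ * _); rewrite opprD addrACA subrr add0r.
  rewrite expr2 !normcM -expr2 normc_real -mulrA.
  rewrite ler_pM ?exprn_ge0 ?normc_ge0 ?normr_ge0 ?combo_lip//.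
  by rewrite ler_pXn2r ?nnegrE ?normc_ge0.
have [Y iY] := choice (fun w => ivp_exists 1 0 (bq w)).
have bY w : cbmeas (Y w) by have [y1 [/primitive_cbmeas]] := iY w.
have Y_le w x : normc w <= s -> 0 <= x <= 1 -> normc (Y w x) <= K.
  move=> ws x01; have [y1 iy] := iY w.
  have [YK _] := HK _ _ _ _ _ _ (bq w) (bq w) (fun x => q_le w x ws)
    (fun x => q_le w x ws) iy iy.
  exact: YK.
have phi_le x : 0 <= x <= 1 -> normc (phi x) <= K.
  have bk := cbmeas_coef kappa bB.
  by have [pK _] := HK _ _ _ _ _ _ bk bk q0_le q0_le iphi iphi; exact: pK.
have Y_dist0 w x : normc w <= s -> 0 <= x <= 1 -> normc (Y w x - phi x) <= K * (s * c1).
  move=> ws x01; have [y1 iy] := iY w; have bk := cbmeas_coef kappa bB.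
  have [_ YK] := HK _ _ _ _ _ _ (bq w) bk (fun x => q_le w x ws) q0_le iy iphi.
  by apply: YK => // t t01; exact: q_dist0.
have Y_lip w w' x : normc w <= s -> normc w' <= s -> 0 <= x <= 1 ->
    normc (Y w x - Y w' x) <= K * (Z ^+ 2 * A * normc (w - w')).
  move=> ws ws' x01; have [y1 iy] := iY w; have [y1' iy'] := iY w'.
  have [_ YK] := HK _ _ _ _ _ _ (bq w) (bq w') (fun x => q_le w x ws)
    (fun x => q_le w' x ws') iy iy'.
  by apply: YK => // t t01; exact: q_lip.
(* Divided by z^2, the equation for w is w = E y - \int combo phi (y - phi). *)
pose E (y : R -> R[i]) :=
  zeta * ((kappa ^+ 2 - z ^+ 2) * cint 0 1 (fun x => (B x)%:C * (phi x * y x)) -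
          'i%C * (kappa - z) * phi 1 * y 1).
have bBphi y : cbmeas y -> cbmeas (fun x => (B x)%:C * (phi x * y x)).
  by move=> by_; apply: cbmeasM; [exact: cbmeas_real|exact: cbmeasM].
have E_le y N : cbmeas y -> 0 <= N -> (forall x, 0 <= x <= 1 -> normc (y x) <= N) ->
    normc (E y) <= cE * (s * s) * N.
  move=> by_ N0 yN; rewrite /E normcM.
  apply: (@le_trans _ _ (cz * (s * s * (2 * Z) * (2 * (b * (K * N))) + s * s * K * N))).
    rewrite ler_pM ?normc_ge0// (le_trans (normcB _ _))// lerD//.
      rewrite normcM ler_pM ?normc_ge0// normc_cint01//; first exact: bBphi.
      move=> x x01; rewrite !normcM normc_real.
      by rewrite !ler_pM ?mulr_ge0 ?normc_ge0 ?normr_ge0 ?B_le ?phi_le ?yN.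
    rewrite !normcM (_ : normc 'i%C = 1); last first.
      by rewrite /= expr0n /= expr1n add0r sqrtr1.
    by rewrite mul1r distcC !ler_pM ?mulr_ge0 ?normc_ge0 ?phi_le ?yN.
  by rewrite le_eqVlt; apply/orP; left; apply/eqP; rewrite cEE; ring.
have EB y y' : cbmeas y -> cbmeas y' -> E y - E y' = E (fun x => y x - y' x).
  move=> by_ by_'; rewrite /E -mulrBr; congr (_ * _).
  have -> : cint 0 1 (fun x => (B x)%:C * (phi x * (y x - y' x))) =
     cint 0 1 (fun x => (B x)%:C * (phi x * y x)) -
     cint 0 1 (fun x => (B x)%:C * (phi x * y' x)).
    rewrite -(cintB (bBphi _ by_) (bBphi _ by_') (lexx 0) (lexx 1)).
    by apply: eq_cint => // x _; ring.
  by move: (cint 0 1 _) (cint 0 1 _) => I1 I2; ring.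
have bD w y : cbmeas y -> cbmeas (fun x => (combo s w x)%:C * (phi x * y x)).
  by move=> by_; apply: cbmeasM; [exact: cbmeas_real|exact: cbmeasM].
pose D w (y : R -> R[i]) := cint 0 1 (fun x => (combo s w x)%:C * (phi x * y x)).
pose G w := E (Y w) - D w (fun x => Y w x - phi x).
have G_le w : normc w <= s -> normc (G w) <= s * (s * c).
  move=> ws; apply: (@le_trans _ _ (s * (s * c2))); last first.
    by rewrite ler_wpM2l// ler_wpM2l// lerDl.
  rewrite (le_trans (normcB _ _))//.
  apply: (@le_trans _ _ (cE * (s * s) * K + 2 * (2 * s * A * (K * (K * (s * c1)))))).
    rewrite lerD ?E_le// => [x x01|]; first exact: Y_le.
    rewrite normc_cint01//; first by apply: bD; exact: cbmeasB.
    move=> x x01; rewrite !normcM normc_real.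
    rewrite !ler_pM ?mulr_ge0 ?normc_ge0 ?normr_ge0//.
    + exact: combo_le.
    + exact: phi_le.
    + exact: Y_dist0.
  by rewrite le_eqVlt; apply/orP; left; apply/eqP; rewrite c2E; ring.
have G_lip w w' : normc w <= s -> normc w' <= s ->
    normc (G w - G w') <= s * c * normc (w - w').
  move=> ws ws'; set n := normc (w - w'); have n0 : 0 <= n by exact: normc_ge0.
  have DE : D w (fun x => Y w x - phi x) - D w' (fun x => Y w' x - phi x) =
      cint 0 1 (fun x => (combo s w x - combo s w' x)%:C * (phi x * (Y w x - phi x))
        + (combo s w' x)%:C * (phi x * (Y w x - Y w' x))).
    rewrite /D -(cintB (bD _ _ (cbmeasB (bY w) bphi)) (bD _ _ (cbmeasB (bY w') bphi))
      (lexx 0) (lexx 1)).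
    by apply: eq_cint => // x _; rewrite rmorphB/=; ring.
  have -> : G w - G w' = E (fun x => Y w x - Y w' x) -
      (D w (fun x => Y w x - phi x) - D w' (fun x => Y w' x - phi x)).
    rewrite -EB// /G; move: (E _) (E _) (D _ _) (D _ _) => a1 a2 a3 a4; ring.
  rewrite DE (le_trans (normcB _ _))//.
  apply: (@le_trans _ _ (cE * (s * s) * (K * (Z ^+ 2 * A * n)) +
     2 * (A * n * (K * (K * (s * c1))) + 2 * s * A * (K * (K * (Z ^+ 2 * A * n)))))).
    rewrite lerD//.
      apply: E_le; [exact: cbmeasB|by rewrite !(mulr_ge0, exprn_ge0)|].
      by move=> x x01; exact: Y_lip.
    rewrite normc_cint01//.
      apply: cbmeasD; last by apply: bD; exact: cbmeasB.
      apply: cbmeasM; last by apply: cbmeasM => //; exact: cbmeasB.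
      by apply: cbmeas_real; apply: bmeasD => //; exact: bmeasN.
    move=> x x01; rewrite (le_trans (le_normcD _ _))// !normcM !normc_real lerD//.
      rewrite !ler_pM ?mulr_ge0 ?normc_ge0 ?normr_ge0//.
      + exact: combo_lip.
      + exact: phi_le.
      + exact: Y_dist0.
    rewrite !ler_pM ?mulr_ge0 ?normc_ge0 ?normr_ge0//.
    + exact: combo_le.
    + exact: phi_le.
    + exact: Y_lip.
  have -> : cE * (s * s) * (K * (Z ^+ 2 * A * n)) +
     2 * (A * n * (K * (K * (s * c1))) + 2 * s * A * (K * (K * (Z ^+ 2 * A * n)))) =
     s * n * (s * (cE * K * Z ^+ 2 * A) + 2 * A * K ^+ 2 * c1 +
              4 * A ^+ 2 * K ^+ 2 * Z ^+ 2) by ring.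
  rewrite [leRHS]mulrAC ler_wpM2l ?mulr_ge0// /c ler_wpDl// c3E !lerD//.
  by rewrite ler_piMl// !(mulr_ge0, exprn_ge0).
have [w ws Gw] := small_contraction s0 sc2 G_le G_lip.
have [y1 iy] := iY w.
exists w, (Y w), y1; split => //.
have wE := cint_combo s w e1 e2 e3.
have DwE : D w (Y w) = E (Y w).
  have : D w (Y w) = w + D w (fun x => Y w x - phi x).
    rewrite -[X in _ = X + _]wE /D.
    have bw : cbmeas (fun x => phi x ^+ 2 * (combo s w x)%:C).
      by apply: cbmeasM; [exact: cbmeasM|exact: cbmeas_real].
    rewrite -(cintD bw (bD _ _ (cbmeasB (bY w) bphi)) (lexx 0) (lexx 1)).
    by apply: eq_cint => // x _; ring.
  move=> ->; transitivity (G w + D w (fun x => Y w x - phi x)).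
    by rewrite Gw.
  by rewrite /G subrK.
have := ivp_wronskian (cbmeas_coef kappa bB) (bq w) iphi iy le11.
have -> : cint 0 1 (fun t => (coef kappa B t - q w t) * (phi t * Y w t)) =
    (kappa ^+ 2 - z ^+ 2) * cint 0 1 (fun x => (B x)%:C * (phi x * Y w x)) -
    z ^+ 2 * D w (Y w).
  rewrite -(cintZ _ (bBphi _ (bY w)) (lexx 0) (lexx 1)).
  rewrite -(cintZ _ (bD w _ (bY w)) (lexx 0) (lexx 1)).
  rewrite -(cintB (cbmeasZ _ (bBphi _ (bY w))) (cbmeasZ _ (bD w _ (bY w)))
     (lexx 0) (lexx 1)).
  by apply: eq_cint => // x _; rewrite /q /coef rmorphD/=; ring.
rewrite DwE /E mulrA /zeta divff ?expf_neq0// mul1r bc_phi.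
move: (cint 0 1 _) => I0 eqW.
have phi10 : phi 1 != 0.
  apply/eqP => phi10.
  have := ivp_no_common_zero (cbmeas_coef kappa bB) iphi le11 phi10.
  by rewrite bc_phi phi10 mulr0 eqxx.
apply: (mulfI phi10); apply/eqP; rewrite -subr_eq0; apply/eqP.
move/eqP: eqW; rewrite -subr_eq0 => /eqP eqW.
by apply: etrans eqW; ring.
Qed.

End perturbation.

(** * The first-order optimality condition *)

Section variations.
Context {R : realType} (b1 b2 : R) (B : R -> R).
Implicit Types (V C : R -> R).

(** The step e is uniform in x, so that all small multiples of V are admissible
    increments of B. *)
Definition feasible V := bmeas V /\ exists2 e : R, 0 < e &
  forall t x, 0 <= t <= e -> 0 <= x <= 1 -> b1 <= B x + t * V x <= b2.

Lemma feasibleD V V' : feasible V -> feasible V' ->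
  feasible (fun x => V x + V' x).
Proof.
move=> [bV [e e0 Ve]] [bV' [e' e'0 Ve']]; split; first exact: bmeasD.
exists (Num.min e e' / 2); first by rewrite divr_gt0// lt_min e0.
move=> t x /andP[t0]; rewrite ler_pdivlMr// le_min => /andP[te te'] x01.
have t2 : 0 <= t * 2 by rewrite mulr_ge0.
have := Ve (t * 2) x; rewrite t2 te => /(_ isT x01).
have := Ve' (t * 2) x; rewrite t2 te' => /(_ isT x01).
by move=> /andP[h1 h2] /andP[h3 h4]; apply/andP; split; lra.
Qed.

Lemma feasibleZ (r : R) V : 0 < r -> feasible V -> feasible (fun x => r * V x).
Proof.
move=> r0 [bV [e e0 Ve]]; split; first exact: bmeasM (bmeas_cst _) bV.
exists (e / r); first by rewrite divr_gt0.
move=> t x /andP[t0]; rewrite ler_pdivlMr// => tre x01.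
by rewrite mulrA Ve// tre mulr_ge0// ltW.
Qed.

Lemma feasibleB C : bmeas B -> (forall x, 0 <= x <= 1 -> b1 <= B x <= b2) ->
  bmeas C -> (forall x, 0 <= x <= 1 -> b1 <= C x <= b2) ->
  feasible (fun x => C x - B x).
Proof.
move=> bB B12 bC C12; split; first exact: bmeasD bC (bmeasN bB).
exists 1 => // t x /andP[t0 t1] x01.
have /andP[h1 h2] := B12 x x01; have /andP[h3 h4] := C12 x x01.
apply/andP; split; nra.
Qed.

Context (phi : R -> R[i]) (bphi : cbmeas phi).

Definition variation V := cint 0 1 (fun x => phi x ^+ 2 * (V x)%:C).

Lemma cbmeas_variation V : bmeas V -> cbmeas (fun x => phi x ^+ 2 * (V x)%:C).
Proof. by move=> bV; apply: cbmeasM; [exact: cbmeasM|exact: cbmeas_real]. Qed.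

Lemma convex_cone_variation : convex_cone [set variation V | V in feasible].
Proof.
split=> [_ _ [V fV <-] [V' fV' <-]|r _ r0 [V fV <-]].
  exists (fun x => V x + V' x); first exact: feasibleD.
  case: fV fV' => bV _ [bV' _]; rewrite /variation.
  rewrite -(cintD (cbmeas_variation bV) (cbmeas_variation bV') (lexx 0) (lexx 1)).
  by apply: eq_cint => // x _; rewrite rmorphD mulrDr.
exists (fun x => r * V x); first exact: feasibleZ.
case: fV => bV _; rewrite /variation.
rewrite -(cintZ _ (cbmeas_variation bV) (lexx 0) (lexx 1)).
by apply: eq_cint => // x _; rewrite rmorphM mulrCA.
Qed.

End variations.

Section first_order_condition.
Context {R : realType} (b1 b2 : R) (B : R -> R) (kappa : R[i]).
Context (phi phi1 : R -> R[i]).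
Hypothesis b1_gt0 : 0 < b1.
Hypothesis bB : bmeas B.
Hypothesis B12 : forall x, 0 <= x <= 1 -> b1 <= B x <= b2.
Hypothesis kappa0 : kappa != 0.
Hypothesis iphi : ivp (coef kappa B) 1 0 phi phi1.
Hypothesis bc_phi : phi1 1 = - 'i%C * kappa * phi 1.
Hypothesis kappa_min : forall (d : R) C y y1, 0 < d -> bmeas C ->
  (forall x, 0 <= x <= 1 -> b1 <= C x <= b2) ->
  ivp (coef (kappa - 'i%C * d%:C) C) 1 0 y y1 ->
  y1 1 != - 'i%C * (kappa - 'i%C * d%:C) * y 1.

(** If the cone of first variations \int phi^2 V were the whole plane, kappa
    could be pushed straight down.  Since the parameter is moved at a prescribed
    eigenvalue, rather than the eigenvalue at a prescribed parameter, it does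
    not matter whether kappa is a simple zero. *)
Lemma variation_halfplane : exists2 w : R[i], w != 0 &
  forall C, bmeas C -> (forall x, 0 <= x <= 1 -> b1 <= C x <= b2) ->
    complex.Re (w * variation phi (fun x => C x - B x)) <= 0.
Proof.
have [pphi _ _ _] := iphi; have bphi := primitive_cbmeas pphi.
pose K := [set variation phi V | V in feasible b1 b2 B].
have KV C : bmeas C -> (forall x, 0 <= x <= 1 -> b1 <= C x <= b2) ->
    K (variation phi (fun x => C x - B x)).
  by move=> bC C12; exists (fun x => C x - B x) => //; exact: feasibleB.
have cK : convex_cone K by exact: convex_cone_variation.
have sep e : e != 0 -> ~ K e -> exists2 w : R[i], w != 0 &
    forall C, bmeas C -> (forall x, 0 <= x <= 1 -> b1 <= C x <= b2) ->
      complex.Re (w * variation phi (fun x => C x - B x)) <= 0.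
  move=> e0 nKe; have [w w0 wK] := separation cK e0 nKe.
  by exists w => // C bC C12; apply: wK; exact: KV.
have [K1|] := pselect (K 1); last exact: sep (oner_neq0 _).
have [Ki|] := pselect (K 'i%C); last first.
  by apply: sep; rewrite eq_complex /= oner_eq0 andbF.
have [Km|] := pselect (K (- 1 - 'i%C)); last first.
  by apply: sep; rewrite eq_complex /= oppr0 addr0 oppr_eq0 oner_eq0.
case: K1 Ki Km => V1 [bV1 [d1 d10 V1P]] e1 [V2 [bV2 [d2 d20 V2P]] e2]
  [V3 [bV3 [d3 d30 V3P]] e3].
have [_ [M1 VM1]] := bV1; have [_ [M2 VM2]] := bV2; have [_ [M3 VM3]] := bV3.
have B_le x : 0 <= x <= 1 -> `|B x| <= b2.
  move=> /B12 /andP[Bx1 Bx2]; rewrite ger0_norm// (le_trans _ Bx1)//; exact: ltW.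
have V_le x : 0 <= x <= 1 -> `|V1 x| + `|V2 x| + `|V3 x| <= M1 + M2 + M3.
  by move=> x01; rewrite !lerD ?VM1 ?VM2 ?VM3.
have [s0 s0_gt0 moves] := quasi_eigenvalue_moves bB B_le bV1 bV2 bV3 V_le kappa0
  iphi bc_phi e1 e2 e3.
(* B + combo s w is the average of the B + 3 t_j V_j, with 0 <= t_j <= 2 s. *)
pose s := Num.min s0 (Num.min d1 (Num.min d2 d3) / 6).
have s_gt0 : 0 < s by rewrite !(lt_min, divr_gt0, s0_gt0, d10, d20, d30).
have : s <= s by []; rewrite {2}/s le_min ler_pdivlMr// !le_min.
move=> /andP[ss0 /and3P[s1 s2 s3]].
have [||w [y [y1 [ws iy bc]]]] := moves s (kappa - 'i%C * (s * s)%:C).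
- by rewrite s_gt0.
- rewrite addrAC subrr add0r normcN normcM normc_real (_ : normc 'i%C = 1).
    by rewrite mul1r ger0_norm// mulr_ge0// ltW.
  by rewrite /= expr0n /= expr1n add0r sqrtr1.
have bs := bmeas_combo bV1 bV2 bV3 s w.
suff S12 (x : R) : 0 <= x <= 1 -> b1 <= B x + combo V1 V2 V3 s w x <= b2.
  have := kappa_min (mulr_gt0 s_gt0 s_gt0) (bmeasD bB bs) S12 iy.
  by rewrite bc eqxx.
move=> x01; rewrite /combo.
have := le_trans (normr_Re w) ws; rewrite ler_norml => /andP[r1 r2].
have := le_trans (normr_Im w) ws; rewrite ler_norml => /andP[i1 i2].
have := V1P (3 * (s + complex.Re w)) x _ x01.
have -> : 0 <= 3 * (s + complex.Re w) <= d1 by apply/andP; split; lra.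
move=> /(_ isT) /andP[h1 h1'].
have := V2P (3 * (s + complex.Im w)) x _ x01.
have -> : 0 <= 3 * (s + complex.Im w) <= d2 by apply/andP; split; lra.
move=> /(_ isT) /andP[h2 h2'].
have := V3P (3 * s) x _ x01.
have -> : 0 <= 3 * s <= d3 by apply/andP; split; lra.
move=> /(_ isT) /andP[h3 h3'].
by apply/andP; split; lra.
Qed.

(** B maximizes Re (w \int phi^2 C) over C, hence is extremal where the weight
    Re (w phi^2) does not vanish; compare with C = B + weight, cut off. *)
Lemma bang_bang : exists2 w : R[i], w != 0 &
  ae01 (fun x => (0 < complex.Re (w * phi x ^+ 2) -> B x = b2) /\
                 (complex.Re (w * phi x ^+ 2) < 0 -> B x = b1)).
Proof.
have [pphi _ _ _] := iphi; have bphi := primitive_cbmeas pphi.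
have [w w0 wP] := variation_halfplane; exists w => //.
pose g x := complex.Re (w * phi x ^+ 2).
have bg : bmeas g by have [] := cbmeasZ w (cbmeasM bphi bphi).
have b12 : b1 <= b2.
  by have /andP[] := B12 (x := 0) (introT andP (conj (lexx _) ler01)); exact: le_trans.
pose C := clamp b1 b2 (fun x => B x + g x).
have bC : bmeas C by apply: bmeas_clamp => //; apply: bmeas_measurable; exact: bmeasD.
have C12 x : 0 <= x <= 1 -> b1 <= C x <= b2 by move=> _; exact: clamp_itv.
have bCB : bmeas (fun x => C x - B x) by exact: bmeasD bC (bmeasN bB).
have h0 x : 0 <= x <= 1 -> 0 <= g x * (C x - B x).
  move=> x01; have /andP[B1 B2] := B12 x01.
  rewrite /C /clamp; have [gx|gx] := leP 0 (g x).
    by rewrite mulr_ge0// subr_ge0 le_max le_min B2 lerDl gx orbT.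
  rewrite mulr_le0 ?(ltW gx)// subr_le0 ge_max B1 ge_min.
  by rewrite gerDl (ltW gx) orbT.
have := rint_eq0_ae (bmeasM bg bCB) h0.
have -> : rint 0 1 (fun x => g x * (C x - B x)) =
    complex.Re (w * variation phi (fun x => C x - B x)).
  rewrite /variation -(cintZ _ (cbmeas_variation bphi bCB) (lexx 0) (lexx 1)).
  rewrite Re_cint; apply: eq_rint => // x _.
  by rewrite mulrA [in RHS]cReM /= mulr0 subr0.
move=> /(_ (wP C bC C12)); apply: ae01S => x; rewrite in_itv/= => /andP[x0 x1].
have /andP[B1 B2] : b1 <= B x <= b2 by rewrite B12// !ltW.
move=> /eqP; rewrite mulf_eq0 => /orP[/eqP gx|CB].
  by rewrite -/(g x) gx ltxx.
move: CB; rewrite subr_eq0 /C /clamp -/(g x) => /eqP CB; split => gx.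
  apply/eqP; rewrite eq_le B2 leNgt; apply/negP => Bb.
  have : B x < Num.max b1 (Num.min b2 (B x + g x)).
    by rewrite lt_max lt_min Bb ltrDl gx orbT.
  by rewrite CB ltxx.
apply/eqP; rewrite eq_le B1 andbT leNgt; apply/negP => Bb.
have : Num.max b1 (Num.min b2 (B x + g x)) < B x.
  by rewrite gt_max gt_min Bb gtrDl gx orbT.
by rewrite CB ltxx.
Qed.

End first_order_condition.

(** * Switching at simple zeros *)

Section crossing.
Context {R : realType}.
Notation mu := (@lebesgue_measure R).
Implicit Types (g : R -> R) (a b c d e k x y : R) (P : R -> Prop).

Lemma ae_itv_inhabited a b P : a < b ->
  {ae mu, forall y, y \in `]a, b[ -> P y} -> exists2 y, y \in `]a, b[ & P y.
Proof.
move=> ab [N [mN N0 sub]]; apply: contrapT => nex.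
have itvN : (`]a, b[ : set R) `<=` N.
  move=> y yab; apply: sub => /= h; apply: nex; exists y => //; exact: h.
have : (mu (`]a, b[ : set R) <= mu N)%E by apply: le_measure; rewrite ?inE.
rewrite [X in (_ <= X)%E]N0 lebesgue_measure_itv/= lte_fin ab -EFinB lee_fin.
by rewrite subr_le0 leNgt ab.
Qed.

Lemma ae_cst_left (B : R -> R) x e e' k c : 0 < e -> 0 < e' ->
  {ae mu, forall y, y \in `]x - e, x[ -> B y = k} ->
  {ae mu, forall y, y \in `]x - e', x[ -> B y = c} -> k = c.
Proof.
move=> e0 e'0 Bk Bc; pose m := Num.min e e'.
have m0 : 0 < m by rewrite lt_min e0.
have [||y _ [<- <-//]] := @ae_itv_inhabited (x - m) x (fun y => B y = k /\ B y = c).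
  by rewrite gtrBl.
apply: aeS (aeI Bk Bc) => y [yk yc]; rewrite in_itv/= => /andP[my yx].
have : m <= e /\ m <= e' by rewrite !ge_min !lexx orbT.
move=> [me me']; split; [apply: yk|apply: yc]; rewrite in_itv/=.
  by rewrite yx andbT; lra.
by rewrite yx andbT; lra.
Qed.

Lemma ae_cst_right (B : R -> R) x e e' k c : 0 < e -> 0 < e' ->
  {ae mu, forall y, y \in `]x, x + e[ -> B y = k} ->
  {ae mu, forall y, y \in `]x, x + e'[ -> B y = c} -> k = c.
Proof.
move=> e0 e'0 Bk Bc; pose m := Num.min e e'.
have m0 : 0 < m by rewrite lt_min e0.
have [||y _ [<- <-//]] := @ae_itv_inhabited x (x + m) (fun y => B y = k /\ B y = c).
  by rewrite ltrDl.
apply: aeS (aeI Bk Bc) => y [yk yc]; rewrite in_itv/= => /andP[xy ym].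
have : m <= e /\ m <= e' by rewrite !ge_min !lexx orbT.
move=> [me me']; split; [apply: yk|apply: yc]; rewrite in_itv/=.
  by rewrite xy; lra.
by rewrite xy; lra.
Qed.

Lemma changes_value_fun (B : R -> R) c d c' d' x : changes_value B c d x ->
  changes_value B c' d' x -> c = c' /\ d = d'.
Proof.
move=> [e e0 [Bc Bd]] [e' e'0 [Bc' Bd']].
by split; [exact: ae_cst_left Bc Bc'|exact: ae_cst_right Bd Bd'].
Qed.

End crossing.

Section switching.
Context {R : realType} (b1 b2 : R) (B g : R -> R).
Notation mu := (@lebesgue_measure R).
Hypothesis b12 : b1 != b2.
Hypothesis B_pos : ae01 (fun y => 0 < g y -> B y = b2).
Hypothesis B_neg : ae01 (fun y => g y < 0 -> B y = b1).

Lemma ae_of_sign (k : R) (P : pred R) a b : 0 <= a -> b <= 1 ->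
  ae01 (fun y => P (g y) -> B y = k) -> (forall y, a < y < b -> P (g y)) ->
  {ae mu, forall y, y \in `]a, b[ -> B y = k}.
Proof.
move=> a0 b1' BP gP; apply: aeS BP => y By; rewrite in_itv/= => yab.
apply: By (gP y yab); rewrite in_itv/=; case/andP: yab => ay yb.
by rewrite (le_lt_trans a0) ?(lt_le_trans yb).
Qed.

(** If g x were nonzero, g would keep its sign around x by continuity, and B would
    be the same constant on both sides. *)
Lemma changes_value_zero c d x : 0 < x < 1 ->
  (exists M, forall y, 0 <= y <= 1 -> `|g y - g x| <= M * `|y - x|) ->
  c != d -> changes_value B c d x -> g x = 0.
Proof.
move=> /andP[x0 x1] [M gM] cd [e e0 [Bc Bd]]; apply/eqP; apply: contraNT cd => gx0.
have M0 : 0 <= M.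
  have := gM 0; rewrite lexx ler01 sub0r normrN (gtr0_norm x0) => /(_ isT).
  by move=> /(le_trans (normr_ge0 _)); rewrite pmulr_lge0.
pose m := Num.min (Num.min x (1 - x)) (`|g x| / (M + 1)).
have M1 : 0 < M + 1 by rewrite ltr_wpDl.
have m0 : 0 < m by rewrite !lt_min x0 subr_gt0 x1 divr_gt0// normr_gt0.
have [mx [m1 mg]] : m <= x /\ m <= 1 - x /\ m * (M + 1) <= `|g x|.
  by rewrite -ler_pdivlMr// !ge_min !lexx ?orbT.
have near y : x - m < y < x + m -> `|g y - g x| < `|g x|.
  move=> /andP[ym my]; apply: le_lt_trans (gM y _) _.
    by apply/andP; split; lra.
  have ym' : `|y - x| < m by rewrite ltr_norml; apply/andP; split; lra.
  have : M * `|y - x| <= M * m by rewrite ler_wpM2l// ltW.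
  by nra.
have main k : ae01 (fun y => (0 < g x) = (0 < g y) /\ g y != 0 -> B y = k) -> c = d.
  move=> BP; have sgn y : x - m < y < x + m -> (0 < g x) = (0 < g y) /\ g y != 0.
    move=> /near; rewrite ltr_norml => /andP[h1 h2].
    move: gx0 h1 h2; case: (ltrgt0P (g x)) => // gx _ h1 h2.
      by have gy : 0 < g y by [lra]; rewrite gy gt_eqF.
    have gy : g y < 0 by lra.
    by rewrite ltNge (ltW gy) lt_eqF.
  have l : {ae mu, forall y, y \in `]x - m, x[ -> B y = k}.
    apply: aeS BP => y By; rewrite in_itv/= => /andP[h1 h2].
    apply: By; first by rewrite in_itv/=; apply/andP; split; lra.
    by apply: sgn; apply/andP; split; lra.
  have r : {ae mu, forall y, y \in `]x, x + m[ -> B y = k}.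
    apply: aeS BP => y By; rewrite in_itv/= => /andP[h1 h2].
    apply: By; first by rewrite in_itv/=; apply/andP; split; lra.
    by apply: sgn; apply/andP; split; lra.
  by rewrite -(ae_cst_left m0 e0 l Bc) -(ae_cst_right m0 e0 r Bd).
case: (ltrgt0P (g x)) gx0 => // gx _.
  apply/eqP/(main b2); apply: ae01S B_pos => y _ By [gy _].
  by apply: By; rewrite -gy.
apply/eqP/(main b1); apply: ae01S B_neg => y _ By [gy gy0].
by apply: By; rewrite lt_neqAle gy0 leNgt -gy -leNgt ltW.
Qed.

(** G g(y) = G^2 (y - x) + O((y - x)^2) has the sign of y - x. *)
Lemma simple_zero_sign x G K : 0 < x < 1 -> g x = 0 -> G != 0 -> 0 <= K ->
  (forall y, 0 <= y <= 1 -> `|g y - G * (y - x)| <= K * (y - x) ^+ 2) ->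
  exists2 e : R, 0 < e & [/\ e <= x, e <= 1 - x,
    forall y, x < y < x + e -> 0 < g y * G &
    forall y, x - e < y < x -> g y * G < 0].
Proof.
move=> /andP[x0 x1] gx0 G0 K0 gK.
have K1 : 0 < K + 1 by rewrite ltr_wpDl.
pose m := Num.min (Num.min x (1 - x)) (`|G| / (K + 1)).
have m0 : 0 < m by rewrite !lt_min x0 subr_gt0 x1 divr_gt0// normr_gt0.
have [mx [m1 mg]] : m <= x /\ m <= 1 - x /\ m * (K + 1) <= `|G|.
  by rewrite -ler_pdivlMr// !ge_min !lexx ?orbT.
have close y : 0 < `|y - x| < m ->
    `|g y * G - G ^+ 2 * (y - x)| < G ^+ 2 * `|y - x|.
  move=> /andP[y0 ym]; have := ym; rewrite ltr_norml => /andP[h1 h2].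
  have -> : g y * G - G ^+ 2 * (y - x) = G * (g y - G * (y - x)) by ring.
  have -> : G ^+ 2 * `|y - x| = `|G| * (`|G| * `|y - x|).
    by rewrite -[G ^+ 2]real_normK ?num_real//; ring.
  rewrite normrM ltr_pM2l ?normr_gt0//.
  apply: le_lt_trans (gK y _) _; first by apply/andP; split; lra.
  rewrite -[(y - x) ^+ 2]real_normK ?num_real// expr2 mulrA ltr_pM2r//.
  have : K * `|y - x| <= K * m by rewrite ler_wpM2l// ltW.
  by lra.
exists m => //; split => // y /andP[h1 h2].
  have yx : `|y - x| = y - x by rewrite gtr0_norm// subr_gt0.
  have := close y; rewrite yx subr_gt0 h1 ltrBlDl h2 => /(_ isT).
  by rewrite ltr_norml => /andP[h _]; lra.
have yx : `|y - x| = x - y by rewrite ltr0_norm ?opprB// subr_lt0.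
have := close y; rewrite yx subr_gt0 h2 ltrBlDr -ltrBlDl h1 => /(_ isT).
by rewrite ltr_norml => /andP[_ h]; lra.
Qed.

Lemma simple_zero_changes x G K : 0 < x < 1 -> g x = 0 -> G != 0 -> 0 <= K ->
  (forall y, 0 <= y <= 1 -> `|g y - G * (y - x)| <= K * (y - x) ^+ 2) ->
  if 0 < G then changes_value B b1 b2 x else changes_value B b2 b1 x.
Proof.
move=> x01 gx0 G0 K0 gK.
have [e e0 [ex e1 right_ left_]] := simple_zero_sign x01 gx0 G0 K0 gK.
case/andP: x01 => x0 x1.
have xe0 : 0 <= x - e by rewrite subr_ge0.
have xe1 : x + e <= 1 by rewrite -lerBrDl.
case: ifP => [Gp|Gn]; exists e => //; split.
- apply: (ae_of_sign (P := fun r => r < 0) xe0 (ltW x1) B_neg) => y yx.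
  by have := left_ y yx; rewrite pmulr_llt0.
- apply: (ae_of_sign (P := fun r => 0 < r) (ltW x0) xe1 B_pos) => y yx.
  by have := right_ y yx; rewrite pmulr_lgt0.
- have {}Gn : G < 0 by rewrite lt_neqAle G0 leNgt Gn.
  apply: (ae_of_sign (P := fun r => 0 < r) xe0 (ltW x1) B_pos) => y yx.
  by have := left_ y yx; rewrite nmulr_llt0.
- have {}Gn : G < 0 by rewrite lt_neqAle G0 leNgt Gn.
  apply: (ae_of_sign (P := fun r => r < 0) (ltW x0) xe1 B_neg) => y yx.
  by have := right_ y yx; rewrite nmulr_lgt0.
Qed.

End switching.

(** * Rotation of phi *)

Section rotation.
Context {R : realType} (b1 b2 : R) (B : R -> R) (kappa : R[i]).
Context (phi phi1 : R -> R[i]).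
Hypothesis b1_gt0 : 0 < b1.
Hypothesis bB : bmeas B.
Hypothesis B12 : forall x, 0 <= x <= 1 -> b1 <= B x <= b2.
Hypothesis iphi : ivp (coef kappa B) 1 0 phi phi1.
Hypothesis bc_phi : phi1 1 = - 'i%C * kappa * phi 1.

Lemma rotation_coef x : 0 <= x <= 1 -> complex.Im (conjc (phi x) * phi1 x) =
  - (2 * complex.Re kappa * complex.Im kappa) *
  rint 0 x (fun t => B t * normc (phi t) ^+ 2).
Proof.
move=> x01; rewrite (ivp_rotation (cbmeas_coef kappa bB) iphi x01) mulNr.
have [pphi _ _ _] := iphi; have bphi := primitive_cbmeas pphi.
case/andP: x01 => x0 x1.
rewrite -(rintZ _ (bmeasM bB (bmeas_sqr_normc bphi)) (lexx 0) x1); congr (- _).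
apply: eq_rint => // t _; rewrite mulrA; congr (_ * _).
by rewrite /coef expr2 cImM /= mulr0 add0r cImM; ring.
Qed.

(** The boundary condition turns Im (conj phi phi') at 1 into
    - Re kappa |phi(1)|^2, whereas this quantity vanishes when kappa is real. *)
Lemma quasi_eigenvalue_nonreal : complex.Re kappa != 0 -> complex.Im kappa != 0.
Proof.
have le11 : 0 <= (1 : R) <= 1 by rewrite lexx ler01.
apply: contra_neq => Im0; have := rotation_coef le11.
rewrite Im0 mulr0 oppr0 mul0r bc_phi.
have -> : complex.Im (conjc (phi 1) * (- 'i%C * kappa * phi 1)) =
    - complex.Re kappa * normc (phi 1) ^+ 2.
  by rewrite sqr_normc_ReIm; case: (phi 1) kappa => ? ? [? ?] /=; ring.
move/eqP; rewrite mulf_eq0 oppr_eq0 => /orP[/eqP//|].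
rewrite expf_eq0/= normc_eq0 => /eqP phi10.
have := ivp_no_common_zero (cbmeas_coef kappa bB) iphi le11 phi10.
by rewrite bc_phi phi10 mulr0 eqxx.
Qed.

(** phi turns about the origin in one direction, fixed by the sign of
    Re kappa Im kappa. *)
Lemma phi_rotates x : complex.Re kappa != 0 -> 0 < x <= 1 ->
  complex.Im (conjc (phi x) * phi1 x) *
  (complex.Re kappa * complex.Im kappa) < 0.
Proof.
move=> Re0 /andP[x0 x1]; rewrite rotation_coef ?(ltW x0)//.
have [pphi _ phi0 _] := iphi.
have b1B t : 0 <= t <= 1 -> b1 <= B t by move=> /B12 /andP[].
have := ivp_mass_gt0 bB b1_gt0 b1B pphi phi0 (introT andP (conj x0 x1)).
set I := rint _ _ _ => I0.
have k0 : 0 < (complex.Re kappa * complex.Im kappa) ^+ 2.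
  by rewrite exprn_even_gt0//= mulf_neq0// quasi_eigenvalue_nonreal.
have -> : - (2 * complex.Re kappa * complex.Im kappa) * I *
    (complex.Re kappa * complex.Im kappa) =
    - (2 * (complex.Re kappa * complex.Im kappa) ^+ 2 * I) by ring.
by rewrite oppr_lt0; apply: mulr_gt0 => //; exact: mulr_gt0.
Qed.

End rotation.

(** * Optimal structures and switching points *)

(** The solution phi inherits the boundary condition at 1 because every solution
    with y'(0) = 0 is y(0) phi.  A structure C with the quasi-eigenvalue
    kappa - i d would contradict the minimality of Im kappa. *)
Lemma optimal_structure {R : realType} (b1 b2 alpha : R) (B : R -> R)
    (phi : R -> R[i]) : 0 < b1 -> b1 < b2 -> alpha != 0 ->
  optimal b1 b2 alpha B -> is_phi B (optimal_kappa b1 b2 alpha) phi ->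
  let kappa := optimal_kappa b1 b2 alpha in
  exists B' phi1, [/\ bmeas B', forall x, b1 <= B' x <= b2,
    ae01 (fun x => B x = B' x), ivp (coef kappa B') 1 0 phi phi1 &
    phi1 1 = - 'i%C * kappa * phi 1 /\
    forall (d : R) C y y1, 0 < d -> bmeas C ->
      (forall x, 0 <= x <= 1 -> b1 <= C x <= b2) ->
      ivp (coef (kappa - 'i%C * d%:C) C) 1 0 y y1 ->
      y1 1 != - 'i%C * (kappa - 'i%C * d%:C) * y 1].
Proof.
move=> b1_gt0 b12 alpha0 optB [phi1 [sphi phi0 phi10]] kappa.
have [AdB _ [kappa0 [y [y1 [sy [x0 x01 yx0] y10 bcy]]]]] := optB.
have [B' [bB' B'12 BB']] := Ad_representative (ltW b12) AdB.
have iphi : ivp (coef kappa B') 1 0 phi phi1.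
  by rewrite -phi0 -phi10; exact: solves_ivp sphi.
have iy := solves_ivp bB' BB' sy; rewrite y10 in iy.
have itv1 : 0 <= (1 : R) <= 1 by rewrite lexx ler01.
have yE := ivp_unique (cbmeas_coef kappa bB') iy _.
have iyphi := ivp_scale (y 0) iphi; rewrite mulr1 mulr0 in iyphi.
have {}yE := yE _ _ iyphi.
have y00 : y 0 != 0.
  apply: contraNneq yx0 => y00; move: x01; rewrite in_itv/= => /yE[-> _].
  by rewrite y00 mul0r.
exists B', phi1; split => //; split.
  have [yE1 y1E1] := yE 1 itv1; move: bcy; rewrite yE1 y1E1 => bcy.
  apply: (mulfI y00); apply/eqP; rewrite -subr_eq0; apply/eqP.
  have -> : y 0 * phi1 1 - y 0 * (- 'i%C * kappa * phi 1) =
      'i%C * kappa * (y 0 * phi 1 - 'i%C * (y 0 * phi1 1) / kappa) +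
      (1 + 'i%C ^+ 2) * (y 0 * phi1 1) by field.
  by rewrite bcy mulr0 add0r sqr_i subrr mul0r.
move=> d C u u1 d0 bC C12 iu; apply/eqP => bcu.
set z := kappa - 'i%C * d%:C.
have Rez : complex.Re z = alpha by rewrite /z /= !(mul0r, mulr0, mul1r, subr0, add0r, oppr0, addr0).
have Imz : complex.Im z = complex.Im kappa - d.
  by rewrite /z /= !(mul0r, mulr0, mul1r, subr0, add0r, oppr0, addr0).
have z0 : z != 0.
  by apply: contraNneq alpha0 => z0; rewrite -Rez z0.
have [_ kmin] := optimal_min optB.
have [_ _ u0 u10] := iu.
suff Kz : quasi_eigenvalues_Ad b1 b2 z.
  by have := kmin z Kz Rez; rewrite -/kappa Imz; lra.
exists C; first exact: Ad_bmeas.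
split => //; exists u, u1; split => //.
- exact: ivp_solves bC iu.
- by exists 0; rewrite ?in_itv/= ?lexx ?ler01// u0 oner_neq0.
- rewrite bcu; apply: etrans (_ : (1 + 'i%C ^+ 2) * u 1 = 0).
    by rewrite -/z; field.
  by rewrite sqr_i subrr mul0r.
Qed.

(** When b = 0 the angle is - acos a, so that -1 has the angle - pi. *)
Lemma polar_angle {R : realType} (a b : R) : a ^+ 2 + b ^+ 2 = 1 ->
  exists2 omega : R, - pi <= omega < pi & cos omega = a /\ sin omega = b.
Proof.
move=> ab; have a1 : -1 <= a <= 1 by apply/andP; split; nra.
have acosa : cos (acos a) = a by apply: acosK; rewrite in_itv.
have sa : sin (acos a) = `|b|.
  by rewrite sin_acos// -sqrtr_sqr; congr Num.sqrt; lra.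
have [b0|b0] := ltP 0 b.
  exists (acos a); last by rewrite acosa sa gtr0_norm.
  rewrite acos_ltpi ?(le_trans _ (acos_ge0 a1)) ?oppr_le0 ?pi_ge0//.
  by case/andP: a1 => a1 ->; rewrite andbT lt_neqAle a1 andbT; nra.
exists (- acos a); last by rewrite cosN sinN acosa sa ler0_norm ?opprK.
rewrite lerN2 acos_lepi//= (le_lt_trans _ (pi_gt0 R))//.
by rewrite oppr_le0 acos_ge0.
Qed.

Section weight.
Context {R : realType} (q phi phi1 : R -> R[i]).
Hypothesis iphi : ivp q 1 0 phi phi1.

Lemma weight_taylor (w : R[i]) : exists2 K, 0 <= K &
  forall x y, 0 <= x <= 1 -> 0 <= y <= 1 ->
    `|complex.Re (w * phi y ^+ 2) - complex.Re (w * phi x ^+ 2) -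
      complex.Re (w * (2 * (phi x * phi1 x))) * (y - x)| <= K * (y - x) ^+ 2.
Proof.
have [p p1 _ _] := iphi.
have d1 := primitiveZ w (primitiveM p p).
have d2 := primitiveZ w (primitiveD (primitiveM p1 p) (primitiveM p p1)).
have [K K0 HK] := primitive_taylor d1 d2; exists K => // x y x01 y01.
apply: le_trans (HK x y x01 y01); apply: le_trans (normr_Re _).
rewrite !cReB [complex.Re (_ * (y - x)%:C)]cReM /= mulr0 subr0.
rewrite !expr2 (_ : 2 * (phi x * phi1 x) = phi1 x * phi x + phi x * phi1 x)//.
by ring.
Qed.

Lemma weight_lipschitz (w : R[i]) x : 0 <= x <= 1 -> exists M : R, forall y,
  0 <= y <= 1 ->
  `|complex.Re (w * phi y ^+ 2) - complex.Re (w * phi x ^+ 2)| <= M * `|y - x|.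
Proof.
have [p _ _ _] := iphi.
have [M M0 HM] := primitive_lipschitz (primitiveZ w (primitiveM p p)).
move=> /andP[x0 x1]; exists M => y /andP[y0 y1].
rewrite !expr2 -cReB (le_trans (normr_Re _))//.
have [xy|yx] := leP x y; first by rewrite ger0_norm ?subr_ge0// HM.
by rewrite distcC ltr0_norm ?subr_lt0// opprB HM// ltW.
Qed.

End weight.

Lemma ray_posP {R : realType} (omega : R) (v : R[i]) :
  ray_pos omega v <->
  exists2 r : R, 0 < r & v = (cos omega +i* sin omega) * r%:C.
Proof. by split=> [[r r0 <-]|[r r0 ->]]; exists r. Qed.

Lemma ray_negP {R : realType} (omega : R) (v : R[i]) :
  ray_neg omega v <->
  exists2 r : R, r < 0 & v = (cos omega +i* sin omega) * r%:C.
Proof. by split=> [[r r0 <-]|[r r0 ->]]; exists r. Qed.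

(** Along the line spanned by e^{i omega}, the derivative of the weight has
    the sign of r times the direction of rotation of phi. *)
Lemma weight_derivative {R : realType} (u f f1 : R[i]) (r : R) :
  conjc u * u = 1 -> f ^+ 2 = u * r%:C ->
  complex.Im (conjc u * (f * f1)) * normc f ^+ 2 =
  r * complex.Im (conjc f * f1).
Proof.
move=> uu f2.
have normE : f * conjc f = (normc f ^+ 2)%:C.
  by rewrite sqr_normc_ReIm; case: f {f2} => a b; apply: eqc => /=; ring.
have E : conjc u * (f * f1) * (normc f ^+ 2)%:C = r%:C * (conjc f * f1).
  rewrite -normE (_ : _ * _ = conjc u * f ^+ 2 * (conjc f * f1)); last by ring.
  by rewrite f2 [conjc u * (u * _)]mulrA uu mul1r.
transitivity (complex.Im (conjc u * (f * f1) * (normc f ^+ 2)%:C)).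
  by rewrite [RHS]cImM /= mulr0 add0r.
by rewrite E cImM /= mul0r addr0.
Qed.

Theorem theorem5p2 (R : realType) (b1 b2 : R) (hb1 : 0 < b1) (hb12 : b1 < b2)
  (alpha : R) (halpha : alpha != 0)
  (B : R -> R) (hB : optimal b1 b2 alpha B)
  (phi : R -> R[i]) (hphi : is_phi B (optimal_kappa b1 b2 alpha) phi) :
  exists2 omega : R, - pi <= omega < pi &
    forall x : R, x \in `]0, 1[ ->
      (changes_value B b1 b2 x <-> ray_pos omega (phi x ^+ 2)) /\
      (changes_value B b2 b1 x <-> ray_neg omega (phi x ^+ 2)).
Proof.
have [B' [phi1 [bB' B'12 BB' iphi [bc kmin]]]] :=
  optimal_structure hb1 hb12 halpha hB hphi.
set kappa := optimal_kappa b1 b2 alpha in iphi bc kmin.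
have Rek : complex.Re kappa != 0 by [].
have kappa0 : kappa != 0 by apply: contraNneq Rek => ->.
have B'12' x : 0 <= x <= 1 -> b1 <= B' x <= b2 by [].
have [w w0 aeB'] := bang_bang hb1 bB' B'12' kappa0 iphi bc kmin.
pose g x := complex.Re (w * phi x ^+ 2).
have aeB := ae01I BB' aeB'.
have B_pos : ae01 (fun y => 0 < g y -> B y = b2).
  by apply: ae01S aeB => y _ [-> [h _]].
have B_neg : ae01 (fun y => g y < 0 -> B y = b1).
  by apply: ae01S aeB => y _ [-> [_ h]].
have b12n : b1 != b2 by rewrite lt_eqF.
have b21n : b2 != b1 by rewrite gt_eqF.
(* The sign s of the rotation decides on which of the two opposite rays
   the weight increases. *)
pose J x := complex.Im (conjc (phi x) * phi1 x).
pose s : R := if 0 < complex.Re kappa * complex.Im kappa then -1 else 1.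
have s2 : s * s = 1 by rewrite /s; case: ifP => _; rewrite ?mulrNN mulr1.
have sJ x : 0 < x < 1 -> 0 < s * J x.
  move=> /andP[x0 x1].
  have := phi_rotates hb1 bB' B'12' iphi bc Rek (introT andP (conj x0 (ltW x1))).
  rewrite -/(J x) /s; case: ifP => [k0|k0].
    by rewrite pmulr_llt0// mulN1r oppr_gt0.
  have [k1|k1] := ltP 0 (complex.Re kappa * complex.Im kappa); first by rewrite k1 in k0.
  by move: k1; rewrite le_eqVlt => /orP[/eqP->|k1]; rewrite ?mulr0 ?ltxx// nmulr_llt0// mul1r.
pose n := normc w.
have n0 : 0 < n by rewrite normc_gt0.
pose p := 'i%C * s%:C * w.
have np : complex.Re p ^+ 2 + complex.Im p ^+ 2 = n ^+ 2.
  rewrite -sqr_normc_ReIm /p !normcM normc_real normc_i mul1r exprMn.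
  by rewrite real_normK ?num_real// expr2 s2 mul1r.
have [|omega omega_pi [cosE sinE]] := @polar_angle R (complex.Re p / n) (- complex.Im p / n).
  by rewrite mulNr sqrrN !exprMn -mulrDl np -exprMn divff ?expr1n// gt_eqF.
exists omega => //.
pose u := cos omega +i* sin omega.
have uu : conjc u * u = 1.
  by apply: eqc; rewrite /u /=; [have := cos2Dsin2 omega; lra|lra].
have wE : w = - 'i%C * s%:C * (n%:C * conjc u).
  have -> : n%:C * conjc u = p.
    by rewrite /u cosE sinE; apply: eqc => /=; field; rewrite gt_eqF.
  have -> : - 'i%C * s%:C * p = - ('i%C ^+ 2) * (s * s)%:C * w.
    by rewrite /p rmorphM; ring.
  by rewrite sqr_i opprK s2 !mul1r.
have ReE v : complex.Re (w * v) = s * n * complex.Im (conjc u * v).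
  rewrite wE -!mulrA; case: (conjc u * v) => a b /=; ring.
have phi_neq0 x : 0 < x < 1 -> phi x != 0.
  move=> /sJ; apply: contraTneq => phi0.
  by rewrite /J phi0 conjc0 mul0r mulr0 ltxx.
have decide x (r : R) : 0 < x < 1 -> r != 0 -> phi x ^+ 2 = u * r%:C ->
    if 0 < r then changes_value B b1 b2 x else changes_value B b2 b1 x.
  move=> x01 r0 vE.
  have x01' : 0 <= x <= 1 by case/andP: x01 => ? ?; rewrite !ltW.
  have gx : g x = 0.
    by rewrite /g vE ReE mulrA uu mul1r /= mulr0.
  have [K K0 HK] := weight_taylor iphi w.
  pose G := complex.Re (w * (2 * (phi x * phi1 x))).
  have phin : 0 < normc (phi x) ^+ 2.
    by rewrite exprn_gt0// normc_gt0 phi_neq0.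
  have GE : G * normc (phi x) ^+ 2 = r * (2 * n * (s * J x)).
    have := weight_derivative (phi1 x) uu vE; rewrite -/(J x) => Jx.
    have -> : G = 2 * s * n * complex.Im (conjc u * (phi x * phi1 x)).
      rewrite /G ReE mulrCA; case: (conjc u * _) => a b /=; ring.
    by rewrite -[LHS]mulrA Jx; ring.
  have pos : 0 < 2 * n * (s * J x) by apply: mulr_gt0 (sJ x x01); exact: mulr_gt0.
  have G0 : G != 0.
    have : G * normc (phi x) ^+ 2 != 0 by rewrite GE mulf_neq0// gt_eqF.
    by rewrite mulf_eq0 negb_or => /andP[].
  have -> : (0 < r) = (0 < G).
    by rewrite -(pmulr_lgt0 G phin) GE (pmulr_lgt0 r pos).
  apply: (simple_zero_changes B_pos B_neg x01 gx G0 K0) => y y01.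
  by have := HK x y x01' y01; rewrite -/(g x) gx subr0.
have on_line x c d : 0 < x < 1 -> c != d -> changes_value B c d x ->
    exists2 r : R, r != 0 & phi x ^+ 2 = u * r%:C.
  move=> x01 cd ch.
  have x01' : 0 <= x <= 1 by case/andP: x01 => ? ?; rewrite !ltW.
  have gx : g x = 0.
    exact: (changes_value_zero B_pos B_neg x01 (weight_lipschitz iphi w x01') cd ch).
  have Im0 : complex.Im (conjc u * phi x ^+ 2) = 0.
    move: gx; rewrite /g ReE => /eqP; rewrite mulf_eq0 mulf_eq0 (gt_eqF n0) orbF.
    by case/orP => /eqP // s0; move: s2; rewrite s0 mul0r => /esym/eqP; rewrite oner_eq0.
  have vE : phi x ^+ 2 = u * (complex.Re (conjc u * phi x ^+ 2))%:C.
    rewrite -[LHS]mul1r -uu [conjc u * u]mulrC -mulrA; congr (_ * _).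
    by apply: eqc.
  exists (complex.Re (conjc u * phi x ^+ 2)) => //.
  apply: contraNneq (phi_neq0 x x01) => r0.
  by move: vE; rewrite r0 mulr0 => /eqP; rewrite expf_eq0.
move=> x; rewrite in_itv/= => x01; split; split.
- move=> ch; have [r r0 vE] := on_line x _ _ x01 b12n ch.
  apply/ray_posP; exists r => //; have := decide x r x01 r0 vE.
  by case: ifP => // _ /(changes_value_fun ch)[/eqP]; rewrite (negbTE b12n).
- move=> /ray_posP[r r0 vE]; have := decide x r x01 _ vE.
  by rewrite r0 gt_eqF//; apply.
- move=> ch; have [r r0 vE] := on_line x _ _ x01 b21n ch.
  apply/ray_negP; exists r => //; have := decide x r x01 r0 vE.
  case: ifP => [_ /(changes_value_fun ch)[/eqP]|rn _].
    by rewrite (negbTE b21n).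
  by rewrite lt_neqAle r0 leNgt rn.
- move=> /ray_negP[r r0 vE]; have := decide x r x01 _ vE.
  by rewrite lt_eqF// ltNge (ltW r0)/=; apply.
Qed.
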